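(* Consider the two-stage stochastic linear program and the inexact regularized L-shaped algorithm described in the context, with descent parameter $\beta\in(0,1)$. Suppose: (i) $X$ is non-empty and bounded with diameter $D$, i.e. $\|x-\bar x\|\le D$ for all $x,\bar x\in X$; (ii) there are $\epsilon_1,\epsilon_2$ such that for every outer iteration $k$ and all $x\in X$, $\hat f_k(x)\in[f(x)-\epsilon_1,f(x)+\epsilon_2]$; (iii) there is $G>0$ such that $\|\hat g_k(x)\|\le G$ for every outer iteration $k$ and all $x\in X$; (iv) for all $k\ge 0$ and $0\le t\le T_k-2$, the bundle function $f_{k,t+1}:\mathbb{R}^n\to\mathbb{R}$ is convex, $G$-Lipschitz continuous, and for all $x\in\mathbb{R}^n$ $$\hat f_k(x)\ge f_{k,t+1}(x)\ge\max\{\hat f_k(x_{k,t+1})+\hat g_k(x_{k,t+1})^T(x-x_{k,t+1}),\ f_{k,t}(x_{k,t+1})+s_{k,t+1}^T(x-x_{k,t+1})\},$$ where $s_{k,t+1}=\rho_k(x_{k,0}-x_{k,t+1})$; (v) $f$ is $\mu$-sharp for some $\mu>0$, i.e. $f(x)-f^*\ge\mu\cdot\mathrm{dist}(x,X^* )$ for all $x\in X$. Let $\bar\epsilon=(\beta+1)(\epsilon_1+\epsilon_2)$, assumed to lie in $(0,1)$. Let $v\in(0,1)$ and suppose the algorithm uses the constant step-size $\rho_k=\rho:=\frac{\beta\mu^2v}{2\bar\epsilon}>0$ for all $k\ge0$. Define $\delta^{SC}:=\frac{4\bar\epsilon}{\beta}$ and $$K^{SC}:=\begin{cases}\max\left\{1,\left\lceil\frac{f(x_{0,0})-f^*-\frac{4\bar\epsilon}{\beta}}{(\frac1v-1)\bar\epsilon}\right\rceil+1\right\}=\mathcal{O}\left(\frac1{\bar\epsilon}\right)&\text{if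 }\frac12\le v<1,\\[2mm]\max\left\{1,\left\lceil\frac{f(x_{0,0})-f^*-\frac{4\bar\epsilon}{\beta}}{(\frac1v-1)\bar\epsilon}\right\rceil+1\right\}+\left\lceil-\log_{(1-\frac\beta2)}\left(\frac1v-1\right)\right\rceil+1=\mathcal{O}\left(\frac1{\bar\epsilon}\right)&\text{if }0<v<\frac12.\end{cases}$$ Then there exists an outer iteration $k\le K^{SC}$ such that $f(x_{k,0})-f^*\le\delta^{SC}$. Furthermore, the total number of inner steps (including null steps) before such a solution is found is at most $$\max\left\{1,\left\lceil\frac{f(x_{0,0})-f^*-\frac{4\bar\epsilon}{\beta}}{(\frac1v-1)\bar\epsilon}\right\rceil+1\right\}\cdot\left(\left\lceil\frac{16}{(1-\beta)^2}\left(\frac{G^2}{(1-v)\mu^2}-1\right)\right\rceil+1\right)=\mathcal{O}\left(\frac1{\bar\epsilon}\right)$$ if $\frac12\le v<1$, and at most $$\max\left\{1,\left\lceil\frac{f(x_{0,0})-f^*-\frac{2\bar\epsilon}{\beta v}}{(\frac1v-1)\bar\epsilon}\right\rceil+1\right\}\cdot\left(\left\lceil\frac{16}{(1-\beta)^2}\left(\frac{G^2}{(1-v)\mu^2}-1\right)\right\rceil+1\right)+\frac{32G^2}{\mu^2v\beta(1-\beta)^2}=\mathcal{O}\left(\frac1{\bar\epsilon}\right)$$ if $0<v<\frac12$.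
   Context: Problem. $\min_{x\in X} f(x):=c^Tx+\mathbb{E}_\xi[Q(x;\xi)]$ with $X=\{x\in\mathbb{R}^n: Ax=b,\ x\ge0\}$ and $Q(x;\xi)=\min_{y\in\mathbb{R}^l}\{q(\xi)^Ty: T(\xi)x+Wy=h(\xi),\ y\ge0\}$, where $A\in\mathbb{R}^{m\times n}$, $b\in\mathbb{R}^m$, $c\in\mathbb{R}^n$, $W\in\mathbb{R}^{r\times l}$ (not depending on $\xi$) and $(T(\xi),q(\xi),h(\xi))\in\mathbb{R}^{r\times n}\times\mathbb{R}^l\times\mathbb{R}^r$. The function $f:X\to\mathbb{R}$ is real-valued and convex, $f^*=\min_{x\in X}f(x)$, $X^*=\{x\in X: f(x)=f^*\}$ is the optimal solution set, and $\mathrm{dist}(x,X^* )=\min_{x^*\in X^*}\|x-x^*\|$. $\|\cdot\|$ is the Euclidean norm. Estimates. For $x\in X$, $U(x;\xi)$ denotes a chosen element of $\arg\max_{u\in\mathbb{R}^r}\{u^T(h(\xi)-T(\xi)x): W^Tu\le q(\xi)\}$. Given a finite set $S_k$ of samples $\xi_i$ of $\xi$, $$\hat f_k(x)=c^Tx+\frac1{|S_k|}\sum_{i\in S_k}Q(x;\xi_i),\qquad \hat g_k(x)=c-\frac1{|S_k|}\sum_{i\in S_k}T(\xi_i)^TU(x;\xi_i)\in\partial\hat f_k(x).$$ Algorithm (inexact regularized L-shaped algorithm). Input: $x_{0,0}\in X$, step-sizes $\rho_k>0$, $\beta\in(0,1)$. For each outer iteration $k=0,1,2,\dots$: draw a sample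 set $S_k$, form $\hat f_k,\hat g_k$, and set $f_{k,0}(x)=\hat f_k(x_{k,0})+\hat g_k(x_{k,0})^T(x-x_{k,0})$. For each inner iteration $t=0,1,2,\dots$: compute $x_{k,t+1}=\arg\min_{x\in X}\{f_{k,t}(x)+\frac{\rho_k}{2}\|x-x_{k,0}\|^2\}$. If $$\beta(\hat f_k(x_{k,0})-f_{k,t}(x_{k,t+1}))\le\hat f_k(x_{k,0})-\hat f_k(x_{k,t+1}),$$ then (serious step) set $T_k=t+1$, $x_{k+1,0}=x_{k,t+1}$, and go to outer iteration $k+1$. Otherwise (null step) form a new bundle function $$f_{k,t+1}(x)=\max\Big\{\max_{j\in J^g_{k,t+1}}\{\hat f_k(x_{k,j})+\hat g_k(x_{k,j})^T(x-x_{k,j})\},\ \max_{j\in J^s_{k,t+1}}\{f_{k,j-1}(x_{k,j})+s_{k,j}^T(x-x_{k,j})\}\Big\},$$ with index sets $J^g_{k,t+1}\subseteq\{0,\dots,t+1\}$, $J^s_{k,t+1}\subseteq\{1,\dots,t+1\}$ and $s_{k,j}=\rho_k(x_{k,0}-x_{k,j})$, and continue with $t+1$. ($T_k=\infty$ if the inner loop never terminates.) Counting. An inner step is one inner iteration (the computation of one point $x_{k,t+1}$). If $k$ is the first outer iteration for which $x_{k,0}$ has the required accuracy, the number of inner steps before such a solution is found is $\sum_{j<k}T_j$.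
   Formalization: The number of inner steps is bounded by the maximum of 0 and the stated bound; this matters only when the starting point is already accurate (zero inner steps), where the stated bound can be negative, e.g. X a single point and μ large compared with G. *)

(* Defs.v *)
From HB Require Import structures.
From mathcomp Require Import all_boot all_order all_algebra.
From mathcomp Require Import all_classical all_reals all_analysis.
Set Implicit Arguments.
Unset Strict Implicit.
Unset Printing Implicit Defensive.
Import Order.TTheory GRing.Theory Num.Theory.
Import numFieldNormedType.Exports.
Local Open Scope classical_set_scope.
Local Open Scope ring_scope.

Definition dot (R : realType) (n : nat) (u v : 'cV[R]_n) : R :=
  \sum_(i < n) u i 0 * v i 0.

(* The library norm on matrices is the sup norm, hence this definition. *)
Definition enorm (R : realType) (n : nat) (u : 'cV[R]_n) : R :=
  Num.sqrt (dot u u).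

Definition vle (R : realType) (n : nat) (u v : 'cV[R]_n) : Prop :=
  forall i, u i 0 <= v i 0.

Definition dist_to (R : realType) (n : nat) (x : 'cV[R]_n) (A : set 'cV[R]_n) : R :=
  inf [set enorm (x - y) | y in A].

Definition is_max (R : realType) (A : set R) (a : R) : Prop :=
  A a /\ ubound A a.

Definition is_min (R : realType) (A : set R) (a : R) : Prop :=
  A a /\ lbound A a.

Definition is_argmin (R : realType) (V : Type) (A : set V) (phi : V -> R)
    (x : V) : Prop :=
  A x /\ forall y, A y -> phi x <= phi y.

Definition is_argmax (R : realType) (V : Type) (A : set V) (phi : V -> R)
    (x : V) : Prop :=
  A x /\ forall y, A y -> phi y <= phi x.

Definition log_base (R : realType) (a x : R) : R := ln x / ln a.

Record tsslp (R : realType) (Xi : Type) (n m r l : nat) := TSSLP {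
  A_of : 'M[R]_(m, n);
  b_of : 'cV[R]_m;
  c_of : 'cV[R]_n;
  W_of : 'M[R]_(r, l);
  T_of : Xi -> 'M[R]_(r, n);
  q_of : Xi -> 'cV[R]_l;
  h_of : Xi -> 'cV[R]_r }.

Definition measurable_data (R : realType) (d : measure_display)
    (Xi : measurableType d) (n m r l : nat) (pb : tsslp R Xi n m r l) : Prop :=
  [/\ forall i j, measurable_fun [set: Xi] (fun z => T_of pb z i j),
      forall i, measurable_fun [set: Xi] (fun z => q_of pb z i 0)
    & forall i, measurable_fun [set: Xi] (fun z => h_of pb z i 0)].

Definition feasible (R : realType) (Xi : Type) (n m r l : nat)
    (pb : tsslp R Xi n m r l) : set 'cV[R]_n :=
  [set x | A_of pb *m x = b_of pb /\ vle 0 x].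

(* Extended-real optimal value of the second stage: +oo when infeasible, -oo
   when unbounded, and otherwise the minimum (a finite linear program attains
   its infimum). *)
Definition recourse (R : realType) (Xi : Type) (n m r l : nat)
    (pb : tsslp R Xi n m r l) (x : 'cV[R]_n) (z : Xi) : \bar R :=
  ereal_inf [set (dot (q_of pb z) y)%:E | y in
    [set y | T_of pb z *m x + W_of pb *m y = h_of pb z /\ vle 0 y]].

(* P is the distribution of xi. *)
Definition objective (R : realType) (d : measure_display)
    (Xi : measurableType d) (n m r l : nat) (pb : tsslp R Xi n m r l)
    (P : probability Xi R) (x : 'cV[R]_n) : \bar R :=
  ((dot (c_of pb) x)%:E + \int[P]_z recourse pb x z)%E.

Definition dual_feasible (R : realType) (Xi : Type) (n m r l : nat)
    (pb : tsslp R Xi n m r l) (z : Xi) : set 'cV[R]_r :=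
  [set u | vle ((W_of pb)^T *m u) (q_of pb z)].

(* A finite sample set is a sequence S of scenarios, so that the same value may
   be drawn several times. *)
Definition fhat (R : realType) (Xi : Type) (n m r l : nat)
    (pb : tsslp R Xi n m r l) (S : seq Xi) (x : 'cV[R]_n) : \bar R :=
  ((dot (c_of pb) x)%:E
   + ((size S)%:R^-1)%:E * \sum_(z <- S) recourse pb x z)%E.

Definition ghat (R : realType) (Xi : Type) (n m r l : nat)
    (pb : tsslp R Xi n m r l) (U : 'cV[R]_n -> Xi -> 'cV[R]_r) (S : seq Xi)
    (x : 'cV[R]_n) : 'cV[R]_n :=
  c_of pb - (size S)%:R^-1 *: \sum_(z <- S) (T_of pb z)^T *m U x z.

(* The affine function fhat(y) + ghat(y)^T (x - y) of x; it is only used at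
   points y of the feasible set, where fhat is finite. *)
Definition gcut (R : realType) (Xi : Type) (n m r l : nat)
    (pb : tsslp R Xi n m r l) (U : 'cV[R]_n -> Xi -> 'cV[R]_r) (S : seq Xi)
    (y x : 'cV[R]_n) : R :=
  fine (fhat pb S y) + dot (ghat pb U S y) (x - y).

(* Numbers of inner iterations are option nat, with None for infinity. *)
Definition ltT (t : nat) (T : option nat) : Prop :=
  if T is Some s then (t < s)%N else True.

(* Outer iteration k takes place iff all earlier inner loops terminate. *)
Definition reached (T : nat -> option nat) (k : nat) : Prop :=
  forall j, (j < k)%N -> T j <> None.

Section Algorithm.
Variables (R : realType) (Xi : pointedType) (n m r l : nat).
Variables (pb : tsslp R Xi n m r l) (beta : R) (rho : nat -> R).
Variables (S : nat -> seq Xi) (U : 'cV[R]_n -> Xi -> 'cV[R]_r).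
Variables (Jg Js : nat -> nat -> set nat).
Variables (x : nat -> nat -> 'cV[R]_n) (F : nat -> nat -> 'cV[R]_n -> R).
Variable T : nat -> option nat.

Definition aggregate_cut (k j : nat) (z : 'cV[R]_n) : R :=
  F k j.-1 (x k j) + dot (rho k *: (x k 0%N - x k j)) (z - x k j).

Definition serious (k t : nat) : Prop :=
  beta * (fine (fhat pb (S k) (x k 0%N)) - F k t (x k t.+1))
  <= fine (fhat pb (S k) (x k 0%N)) - fine (fhat pb (S k) (x k t.+1)).

(* S k, U, Jg, Js are the samples and the choices made along the run; x k t,
   F k t and T k are the iterates, the bundle functions and the numbers of inner
   iterations. Values at indices that the run does not produce (k not reached,
   or t beyond T k) are unconstrained. *)
Record Lshaped_run : Prop := {
  run_init : feasible pb (x 0%N 0%N);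
  run_stepsize : forall k, 0 < rho k;
  run_samples : forall k, reached T k -> (0 < size (S k))%N;
  run_dual : forall k, reached T k -> forall y z, feasible pb y -> z \in S k ->
    is_argmax (dual_feasible pb z)
      (fun u => dot u (h_of pb z - T_of pb z *m y)) (U y z);
  run_first_model : forall k, reached T k ->
    forall z, F k 0%N z = gcut pb U (S k) (x k 0%N) z;
  run_argmin : forall k t, reached T k -> ltT t (T k) ->
    is_argmin (feasible pb)
      (fun z => F k t z + rho k / 2 * enorm (z - x k 0%N) ^+ 2) (x k t.+1);
  run_length : forall k, reached T k ->
    if T k is Some s then
      exists t, [/\ s = t.+1, serious k t,
                    forall t', (t' < t)%N -> ~ serious k t'
                  & x k.+1 0%N = x k s]
    else forall t, ~ serious k t;
  run_bundle : forall k t, reached T k -> ltT t.+1 (T k) ->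
    [/\ Jg k t.+1 `<=` [set j | (j <= t.+1)%N],
        Js k t.+1 `<=` [set j | (0 < j <= t.+1)%N]
      & forall z, is_max
          ([set gcut pb U (S k) (x k j) z | j in Jg k t.+1]
           `|` [set aggregate_cut k j z | j in Js k t.+1])
          (F k t.+1 z)] }.

End Algorithm.

Section Bounds.
Variable R : realType.

(* Below gap stands for f(x00) - f* and e for the error level epsilon-bar. *)

Definition stage_count (v gap thr e : R) : int :=
  Num.max 1 (Num.ceil ((gap - thr) / ((v^-1 - 1) * e)) + 1).

Definition K_SC (beta v gap e : R) : int :=
  if 2^-1 <= v then stage_count v gap (4 * e / beta) e
  else stage_count v gap (4 * e / beta) e
       + Num.ceil (- log_base (1 - beta / 2) (v^-1 - 1)) + 1.

Definition steps_per_outer (beta mu G v : R) : int :=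
  Num.ceil (16 / (1 - beta) ^+ 2 * (G ^+ 2 / ((1 - v) * mu ^+ 2) - 1)) + 1.

Definition inner_bound (beta mu G v gap e : R) : R :=
  if 2^-1 <= v then
    (stage_count v gap (4 * e / beta) e * steps_per_outer beta mu G v)%:~R
  else
    (stage_count v gap (2 * e / (beta * v)) e
       * steps_per_outer beta mu G v)%:~R
    + 32 * G ^+ 2 / (mu ^+ 2 * v * beta * (1 - beta) ^+ 2).

End Bounds.

(* Main.v *)
Require Import Defs.
From HB Require Import structures.
From mathcomp Require Import all_boot all_order all_algebra.
From mathcomp Require Import all_classical all_reals all_analysis.
From mathcomp Require Import ring lra.
Import Order.TTheory GRing.Theory Num.Theory.
Import numFieldNormedType.Exports.
Local Open Scope classical_set_scope.
Local Open Scope ring_scope.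

(* Write e for epsilon-bar and g for the optimality gap of the current center.
   Comparing the proximal subproblem with the points of the segment from the
   center to a solution, and using sharpness, the decrease predicted by any model
   is at least s g - rho s^2 g^2 / (2 mu^2) - (eps1 + eps2) for 0 < s <= 1, and a
   serious step realizes the fraction beta of it up to eps1 + eps2.
   For g > 2 e / (beta v) the choice s = mu^2 / (rho g) decreases the gap by
   (1/v - 1) e; below that threshold s = 1 contracts g - 2 e / beta by the factor
   1 - beta / 2.
   Between serious steps, the predicted decrease D obeys the recursion
   D' <= D - (1 - beta)^2 rho D^2 / (8 G^2) and starts below G^2 / (2 rho), so
   1/D grows linearly and the lower bound on D limits the number of null steps;
   in the contraction regime these limits form a geometric sum.
   That the cuts minorize the sample average is linear programming duality. *)

(** * Euclidean geometry and Farkas' lemma *)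

Section DotProduct.
Context {R : realType} {n : nat}.
Implicit Types (u v w : 'cV[R]_n) (a : R).

Lemma dotE u v : dot u v = (u^T *m v) 0 0.
Proof. by rewrite mxE; apply: eq_bigr => i _; rewrite mxE. Qed.

Lemma dotC u v : dot u v = dot v u.
Proof. by apply: eq_bigr => i _; rewrite mulrC. Qed.

Lemma dotDr u v w : dot u (v + w) = dot u v + dot u w.
Proof. by rewrite !dotE mulmxDr mxE. Qed.

Lemma dotDl u v w : dot (u + v) w = dot u w + dot v w.
Proof. by rewrite dotC dotDr !(dotC w). Qed.

Lemma dotZr a u v : dot u (a *: v) = a * dot u v.
Proof. by rewrite !dotE -scalemxAr mxE. Qed.

Lemma dotZl a u v : dot (a *: u) v = a * dot u v.
Proof. by rewrite dotC dotZr dotC. Qed.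

Lemma dotNr u v : dot u (- v) = - dot u v.
Proof. by rewrite -scaleN1r dotZr mulN1r. Qed.

Lemma dotNl u v : dot (- u) v = - dot u v.
Proof. by rewrite dotC dotNr dotC. Qed.

Lemma dotBr u v w : dot u (v - w) = dot u v - dot u w.
Proof. by rewrite dotDr dotNr. Qed.

Lemma dotBl u v w : dot (u - v) w = dot u w - dot v w.
Proof. by rewrite dotDl dotNl. Qed.

Lemma dot0r u : dot u 0 = 0.
Proof. by rewrite dotE mulmx0 mxE. Qed.

Lemma dot_suml (I : Type) (s : seq I) (h : I -> 'cV[R]_n) u :
  dot (\sum_(i <- s) h i) u = \sum_(i <- s) dot (h i) u.
Proof.
elim: s => [|i s ih]; first by rewrite !big_nil dotC dot0r.
by rewrite !big_cons dotDl ih.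
Qed.

Lemma dot_ge0 u : 0 <= dot u u.
Proof. by apply: sumr_ge0 => i _; rewrite -expr2 sqr_ge0. Qed.

Lemma enorm_ge0 u : 0 <= enorm u.
Proof. exact: sqrtr_ge0. Qed.

Lemma sqr_enorm u : enorm u ^+ 2 = dot u u.
Proof. by rewrite sqr_sqrtr // dot_ge0. Qed.

Lemma enormZ a u : enorm (a *: u) = `|a| * enorm u.
Proof.
apply/eqP; rewrite -(@eqrXn2 _ 2) ?enorm_ge0 ?mulr_ge0 ?enorm_ge0 //.
by rewrite exprMn !sqr_enorm dotZl dotZr real_normK ?num_real // mulrA -expr2.
Qed.

Lemma enormN u : enorm (- u) = enorm u.
Proof. by rewrite -scaleN1r enormZ normrN normr1 mul1r. Qed.

Lemma enormBC u v : enorm (u - v) = enorm (v - u).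
Proof. by rewrite -enormN opprB. Qed.

Lemma enorm_eq0 u : enorm u = 0 -> u = 0.
Proof.
move=> e0; have /eqP : dot u u = 0 by rewrite -sqr_enorm e0 expr0n.
rewrite psumr_eq0 => [/allP u0|i _]; last by rewrite -expr2 sqr_ge0.
apply/matrixP => i j; rewrite ord1 mxE; apply/eqP.
by move: (u0 i (mem_index_enum _)); rewrite /= mulf_eq0 orbb.
Qed.

Lemma dot_le_enorm u v : dot u v <= enorm u * enorm v.
Proof.
have h := dot_ge0 (enorm v *: u - enorm u *: v).
have : 0 <= (enorm u * enorm v) * (enorm u * enorm v - dot u v).
  move: h; rewrite !(dotBr, dotBl, dotZl, dotZr) (dotC v u) -!sqr_enorm => h.
  nra.
have := mulr_ge0 (enorm_ge0 u) (enorm_ge0 v).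
rewrite le0r => /orP[|p]; last by rewrite pmulr_rge0 // subr_ge0.
rewrite mulf_eq0 => /orP[]/eqP e0 _; rewrite e0 ?mul0r ?mulr0.
  by rewrite (enorm_eq0 _ e0) dotC dot0r.
by rewrite (enorm_eq0 _ e0) dot0r.
Qed.

End DotProduct.

Lemma dot_trmul (R : realType) (p q : nat) (M : 'M[R]_(p, q)) u v :
  dot (M^T *m u) v = dot u (M *m v).
Proof. by rewrite !dotE trmx_mul trmxK mulmxA. Qed.

Section Farkas.
Context {R : realType} {V : lmodType R}.

Definition linear_form (g : V -> R) : Prop :=
  forall a u w, g (a *: u + w) = a * g u + g w.

Lemma linear_form0 g : linear_form g -> g 0 = 0.
Proof. by move=> lg; have := lg 1 0 0; rewrite scaler0 addr0; lra. Qed.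

Lemma linear_formZ g a u : linear_form g -> g (a *: u) = a * g u.
Proof. by move=> lg; rewrite -[a *: u]addr0 lg linear_form0 // addr0. Qed.

(* Bartl's induction: if the last inequality is not redundant, some x' violates
   the conclusion with a x' = 1, and projecting along x' onto ker a removes it. *)
Lemma farkas_forms (p : nat) (A : 'I_p -> V -> R) (g : V -> R) :
  (forall i, linear_form (A i)) -> linear_form g ->
  (forall y, (forall i, A i y <= 0) -> g y <= 0) ->
  exists lam : 'I_p -> R, (forall i, 0 <= lam i) /\
    forall y, g y = \sum_(i < p) lam i * A i y.
Proof.
elim: p A g => [|p ih] A g lA lg Ag.
  exists (fun=> 0); split=> // y; rewrite big_ord0.
  have : g y <= 0 by apply: Ag => -[].
  have : g (- y) <= 0 by apply: Ag => -[].
  by rewrite -scaleN1r linear_formZ //; lra.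
set wd : 'I_p -> 'I_p.+1 := widen_ord (leqnSn p).
have wdE i : wd i = lift ord_max i by apply/val_inj/esym/lift_max.
set a := A ord_max.
have [h|] := pselect (forall y, (forall i, A (wd i) y <= 0) -> g y <= 0).
  have [lam [lam0 gE]] := ih (fun i => A (wd i)) g (fun i => lA _) lg h.
  exists (fun i => if unlift ord_max i is Some j then lam j else 0); split.
    by move=> i; case: unlift.
  move=> y; rewrite gE big_ord_recr /= unlift_none mul0r addr0.
  apply: eq_bigr => i _.
  by rewrite -/(wd i) wdE liftK.
move=> /existsNP[x0 /not_implyP[Ax0 /negP]]; rewrite -ltNge => gx0.
have ax0 : 0 < a x0.
  rewrite ltNge; apply/negP => ax0; move: gx0; rewrite ltNge Ag // => i.
  case: (unliftP ord_max i) => [j ->|-> //]; by rewrite -wdE.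
pose x' := (a x0)^-1 *: x0.
have ax' : a x' = 1 by rewrite linear_formZ ?mulVf ?gt_eqF //; exact: lA.
have gx' : 0 < g x' by rewrite linear_formZ // mulr_gt0 // invr_gt0.
have Ax' i : A (wd i) x' <= 0 by rewrite linear_formZ // mulr_ge0_le0 // invr_ge0 ltW.
have lp (h : V -> R) : linear_form h -> linear_form (fun y => h y - h x' * a y).
  by move=> lh c u w; rewrite lh /a (lA ord_max); ring.
have [||y Ay|lam [lam0 gE]] := ih (fun i y => A (wd i) y - A (wd i) x' * a y)
   (fun y => g y - g x' * a y).
- by move=> i; apply: lp.
- exact: lp.
- have proj (h : V -> R) : linear_form h -> h y - h x' * a y = h ((- a y) *: x' + y).
    by move=> lh; rewrite lh; ring.
  rewrite proj //; apply: Ag => i.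
  case: (unliftP ord_max i) => [j ->|->]; last first.
    by rewrite -/a -proj; [rewrite ax' mul1r subrr|exact: lA].
  by rewrite -wdE -proj.
(* The multiplier of [a] is forced by evaluating the identity at x', where [a] is 1. It is
   nonnegative because g x' > 0 while the other forms are nonpositive at x'. *)
pose c := g x' - \sum_(i < p) lam i * A (wd i) x'.
exists (fun i => if unlift ord_max i is Some j then lam j else c); split.
  move=> i; case: unlift => [j|]; rewrite ?lam0 // subr_ge0 (le_trans _ (ltW gx')) //.
  by apply: sumr_le0 => j _; rewrite mulr_ge0_le0.
move=> y; rewrite big_ord_recr /= unlift_none -/a.
under eq_bigr => i _ do rewrite -/(wd i) [in unlift _ _]wdE liftK.
have /eqP := gE y; rewrite subr_eq => /eqP ->.
have -> : \sum_(i < p) lam i * (A (wd i) y - A (wd i) x' * a y) =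
    \sum_(i < p) lam i * A (wd i) y - (\sum_(i < p) lam i * A (wd i) x') * a y.
  by rewrite mulr_suml -sumrB; apply: eq_bigr => i _; ring.
by rewrite /c; ring.
Qed.

End Farkas.

(** * Duality in the second stage *)

Section SecondStage.
Context {R : realType} {Xi : Type} {n m r l : nat}.
Variable pb : tsslp R Xi n m r l.
Implicit Types (y : 'cV[R]_n) (z : Xi) (u : 'cV[R]_r).

Lemma dot_vle p (a b c : 'cV[R]_p) : vle a b -> vle 0 c -> dot a c <= dot b c.
Proof.
move=> ab c0; apply: ler_sum => i _; apply: ler_wpM2r; last exact: ab.
by have := c0 i; rewrite mxE.
Qed.

(** Weak duality: a primal feasible w satisfies W w = h - T y, and u.(W w) = (W^T u).w is at most
    q.w because w >= 0. *)
Lemma recourse_ge y z u : dual_feasible pb z u ->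
  ((dot u (h_of pb z - T_of pb z *m y))%:E <= recourse pb y z)%E.
Proof.
move=> uD; apply: le_ereal_inf_tmp => _ [w [<- w0] <-].
by rewrite lee_fin [T_of _ _ *m _ + _]addrC addrK -dot_trmul; apply: dot_vle.
Qed.

(* Farkas' lemma on the homogenized dual system in (u, s), s >= 0: the value of
   the maximizer u0 bounds every ray, so it is certified by a primal point. *)
Lemma recourse_le y z u0 :
  is_argmax (dual_feasible pb z)
    (fun u => dot u (h_of pb z - T_of pb z *m y)) u0 ->
  (recourse pb y z <= (dot u0 (h_of pb z - T_of pb z *m y))%:E)%E.
Proof.
set w := h_of pb z - _; case=> u0D u0max; set d := dot u0 w.
pose A (i : 'I_l.+1) (us : 'cV[R]_r * R^o) : R :=
  if unlift ord_max i is Some j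
  then ((W_of pb)^T *m us.1) j 0 - us.2 * q_of pb z j 0 else - us.2.
pose g (us : 'cV[R]_r * R^o) : R := dot us.1 w - us.2 * d.
have lA i : linear_form (A i).
  move=> a [u s] [u' s']; rewrite /A /=; case: unlift => [j|].
    by rewrite mulmxDr -scalemxAr !mxE /GRing.scale /=; ring.
  by rewrite /GRing.scale /=; ring.
have lg : linear_form g.
  by move=> a [u s] [u' s']; rewrite /g /= dotDl dotZl /GRing.scale /=; ring.
have [|lam [lam0 gE]] := farkas_forms _ _ _ lA lg.
  case=> u s Aus; rewrite /g /=.
  have s0 : 0 <= s by have := Aus ord_max; rewrite /A unlift_none /= oppr_le0.
  have Wu j : ((W_of pb)^T *m u) j 0 <= s * q_of pb z j 0.
    by have := Aus (lift ord_max j); rewrite /A liftK /= subr_le0.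
  (* For s > 0 the scaled point u / s is dual feasible. For s = 0, u is a recession direction, so u0
     + u is dual feasible and maximality of u0 gives u.w <= 0. *)
  have [sp|sn] := ltrP 0 s.
    rewrite subr_le0 -ler_pdivrMl // -dotZl; apply: u0max => j.
    by rewrite -scalemxAr mxE ler_pdivrMl.
  have {s0 sn} s_0 : s = 0 by apply/eqP; rewrite eq_le sn s0.
  have : dot (u0 + u) w <= d.
    apply: u0max => j; rewrite mulmxDr mxE.
    have := u0D j; have := Wu j; rewrite s_0 mul0r; lra.
  by rewrite dotDl -/d s_0; lra.
(* The multipliers of the dual constraints form the primal point: testing the identity at (w - W x,
   0) gives W x = w, and testing it at (0, 1) gives q.x <= d. *)
pose x : 'cV[R]_l := \col_j lam (lift ord_max j).
have gx u s : g (u, s) = dot u (W_of pb *m x) - s * dot (q_of pb z) x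
                         - lam ord_max * s.
  rewrite gE big_ord_recr /= /A unlift_none /= mulrN; congr (_ - _).
  rewrite -dot_trmul /dot mulr_sumr -sumrB; apply: eq_bigr => j _.
  have -> : widen_ord (leqnSn l) j = lift ord_max j by apply/val_inj/esym/lift_max.
  by rewrite liftK /x [(\col__ _) _ _]mxE; ring.
have Wx : w = W_of pb *m x.
  apply/subr0_eq/enorm_eq0/eqP; rewrite -sqrf_eq0 sqr_enorm dotBr.
  by have := gx (w - W_of pb *m x) 0; rewrite /g /=; lra.
have qx : dot (q_of pb z) x <= d.
  have := gx 0 1; rewrite /g /= !(dotC 0) !dot0r.
  by have := lam0 ord_max; lra.
apply: (@le_trans _ _ (dot (q_of pb z) x)%:E); last by rewrite lee_fin.
apply: ereal_inf_lbound; exists x => //; split.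
  by rewrite -Wx /w addrC subrK.
by move=> j; rewrite !mxE.
Qed.

Lemma recourseE y z u :
  is_argmax (dual_feasible pb z)
    (fun u => dot u (h_of pb z - T_of pb z *m y)) u ->
  recourse pb y z = (dot u (h_of pb z - T_of pb z *m y))%:E.
Proof.
move=> umax; apply/eqP; rewrite eq_le recourse_le // recourse_ge //.
by case: umax.
Qed.

End SecondStage.

Section SampleAverage.
Context {R : realType} {Xi : eqType} {n m r l : nat}.
Variables (pb : tsslp R Xi n m r l) (U : 'cV[R]_n -> Xi -> 'cV[R]_r).
Variable S : seq Xi.
Hypothesis U_argmax : forall y z, feasible pb y -> z \in S ->
  is_argmax (dual_feasible pb z)
    (fun u => dot u (h_of pb z - T_of pb z *m y)) (U y z).
Implicit Types y : 'cV[R]_n.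

Lemma fhatE y : feasible pb y ->
  fhat pb S y = (dot (c_of pb) y + (size S)%:R^-1 *
    \sum_(z <- S) dot (U y z) (h_of pb z - T_of pb z *m y))%:E.
Proof.
move=> yX; rewrite /fhat EFinD EFinM; congr (_ + _ * _)%E.
rewrite big_seq [in RHS]big_seq -sumEFin; apply: eq_bigr => z zS.
by apply: recourseE; apply: U_argmax.
Qed.

(** The dual feasible set does not involve the first-stage point, so [U y z] competes in the maximum
    that defines [U w z]; the terms in [c_of pb] cancel. *)
Lemma gcut_le_fhat y w : feasible pb y -> feasible pb w ->
  gcut pb U S y w <= fine (fhat pb S w).
Proof.
move=> yX wX; rewrite /gcut !fhatE //= /ghat dotBl dotZl dot_suml !dotBr.
rewrite -!addrA.
suff : (size S)%:R^-1 * \sum_(z <- S) dot (U y z) (h_of pb z - T_of pb z *m y)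
  - (size S)%:R^-1 * \sum_(z <- S) dot ((T_of pb z)^T *m U y z) (w - y)
  <= (size S)%:R^-1 * \sum_(z <- S) dot (U w z) (h_of pb z - T_of pb z *m w).
  lra.
rewrite -mulrBr -sumrB; apply: ler_wpM2l; first by rewrite invr_ge0.
rewrite big_seq [leRHS]big_seq; apply: ler_sum => z zS.
rewrite dot_trmul -dotBr mulmxBr opprB addrA subrK.
have [_ /(_ (U y z))] := U_argmax w z wX zS.
by apply; case: (U_argmax y z yX zS).
Qed.

End SampleAverage.

(** * Null steps *)

(** Since (1/D + c)(D - c D^2) = 1 - (c D)^2 <= 1, each step adds at least c to 1/D. *)
Lemma inv_ge_quadratic_decrease (R : realType) (D : nat -> R) (c : R) (N : nat) :
  0 <= c -> (forall t, (t <= N)%N -> 0 < D t) ->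
  (forall t, (t < N)%N -> D t.+1 <= D t - c * D t ^+ 2) ->
  (D 0%N)^-1 + c * N%:R <= (D N)^-1.
Proof.
move=> c0; elim: N => [|N ih] D0 dec; first by rewrite mulr0 addr0.
have {}ih := ih (fun t h => D0 t (leqW h)) (fun t h => dec t (leqW h)).
have p := D0 N (leqnSn N); have p1 := D0 N.+1 (leqnn _).
apply: (@le_trans _ _ ((D N)^-1 + c)).
  by rewrite -natr1 mulrDr mulr1 addrA lerD2r.
rewrite -[leRHS]mul1r ler_pdivlMr //.
have ic : 0 <= (D N)^-1 + c by rewrite addr_ge0 // invr_ge0 ltW.
apply: (le_trans (ler_wpM2l ic (dec N (leqnn _)))).
have -> : ((D N)^-1 + c) * (D N - c * D N ^+ 2) = 1 - (c * D N) ^+ 2.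
  by field; rewrite gt_eqF.
by rewrite gerBl sqr_ge0.
Qed.

Section NullSteps.
Context {R : realType} {n : nat}.
Variables (X : set 'cV[R]_n) (fh : 'cV[R]_n -> R) (gh : 'cV[R]_n -> 'cV[R]_n).
Variables (z : nat -> 'cV[R]_n) (F : nat -> 'cV[R]_n -> R).
Variables (rho G beta : R) (N : nat).
Hypotheses (rho0 : 0 < rho) (G0 : 0 < G) (beta01 : 0 < beta < 1).
Hypothesis X_convex : forall y w s, X y -> X w -> 0 <= s <= 1 ->
  X (y + s *: (w - y)).
Hypothesis z0X : X (z 0%N).
Hypothesis z_argmin : forall t, (t <= N)%N ->
  is_argmin X (fun y => F t y + rho / 2 * enorm (y - z 0%N) ^+ 2) (z t.+1).
Hypothesis F0E : forall y, F 0%N y = fh (z 0%N) + dot (gh (z 0%N)) (y - z 0%N).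
Hypothesis gh_le : forall y, X y -> enorm (gh y) <= G.
Hypothesis F_convex : forall t y w s, (t <= N)%N -> 0 <= s <= 1 ->
  F t (y + s *: (w - y)) <= (1 - s) * F t y + s * F t w.
Hypothesis F_lipschitz : forall t y w, (t <= N)%N ->
  F t y - F t w <= G * enorm (y - w).
Hypothesis F_cut : forall t y, (t < N)%N ->
  fh (z t.+1) + dot (gh (z t.+1)) (y - z t.+1) <= F t.+1 y.
Hypothesis F_aggregate : forall t y, (t < N)%N ->
  F t (z t.+1) + dot (rho *: (z 0%N - z t.+1)) (y - z t.+1) <= F t.+1 y.
Hypothesis null_step : forall t, (t < N)%N ->
  fh (z 0%N) - fh (z t.+1) < beta * (fh (z 0%N) - F t (z t.+1)).

(** Unlike the decrease in the serious test, this one keeps the quadratic term, so that it measures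
    the optimal value of the t-th subproblem. *)
Definition prox_gap t :=
  fh (z 0%N) - (F t (z t.+1) + rho / 2 * enorm (z t.+1 - z 0%N) ^+ 2).

(** Controls the slope of the aggregate cut. With q = z t.+1 - z 0, optimality gives rho |q|^2 <= F
    t (z 0) - F t (z t.+1), and the Lipschitz bound makes the right side at most G |q|. *)
Lemma aggregate_bound t : (t <= N)%N -> rho * enorm (z t.+1 - z 0%N) <= G.
Proof.
move=> tN; set q := z t.+1 - z 0%N.
have [zX zmin] := z_argmin _ tN.
(* Comparing z t.+1 with the points of the segment to the center and letting s
   tend to 0 gives the factor rho instead of rho / 2. *)
have step s : 0 < s <= 1 ->
    rho * enorm q ^+ 2 <= F t (z 0%N) - F t (z t.+1) + s * (rho * enorm q ^+ 2).
  case/andP=> s0 s1; have s01 : 0 <= s <= 1 by rewrite ltW.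
  have /= := zmin _ (X_convex _ _ _ zX z0X s01).
  have -> : z t.+1 + s *: (z 0%N - z t.+1) - z 0%N = (1 - s) *: q.
    by rewrite addrAC -/q -(opprB (z t.+1)) -/q scalerN scalerBl scale1r.
  rewrite enormZ ger0_norm ?subr_ge0 // -/q => h1.
  have h2 := F_convex t (z t.+1) (z 0%N) s tN s01.
  have h3 : 0 <= rho * enorm q ^+ 2 by rewrite mulr_ge0 ?sqr_ge0 // ltW.
  rewrite -(ler_pM2l s0); nra.
have : rho * enorm q ^+ 2 <= F t (z 0%N) - F t (z t.+1).
  have qq : 0 <= rho * enorm q ^+ 2 by rewrite mulr_ge0 ?sqr_ge0 // ltW.
  apply/ler_addgt0Pr => e e0.
  (* The choice s = e / (rho |q|^2) makes the error term equal to e; if it is at least 1, s = 1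
     suffices. *)
  have [] := lerP (rho * enorm q ^+ 2) e => [le_e|lt_e].
    by apply: (le_trans (step 1 _)); rewrite ?ltr01 ?lexx // mul1r lerD2l.
  have p : 0 < rho * enorm q ^+ 2 by exact: lt_trans lt_e.
  apply: (le_trans (step (e / (rho * enorm q ^+ 2)) _)).
    by rewrite divr_gt0 // ler_pdivrMr // mul1r ltW.
  by rewrite divfK // gt_eqF.
move=> /le_trans/(_ (F_lipschitz _ _ _ tN)); rewrite enormBC -/q expr2 mulrA.
have := enorm_ge0 q; rewrite le0r => /orP[/eqP -> _|p]; first by rewrite mulr0 ltW.
by rewrite ler_pM2r.
Qed.

(** The first model is affine with slope g, so the gap is -g.q - rho/2 |q|^2, whose maximum over all
    q is |g|^2 / (2 rho). *)
Lemma prox_gap0_le : prox_gap 0 <= G ^+ 2 / (2 * rho).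
Proof.
have : dot (gh (z 0%N)) (gh (z 0%N)) <= G ^+ 2.
  by rewrite -sqr_enorm lerXn2r ?nnegrE ?enorm_ge0 ?(ltW G0) // gh_le.
rewrite /prox_gap F0E; move: (z 1%N - z 0%N) (gh (z 0%N)) => q g gG.
have := dot_ge0 (g + rho *: q).
rewrite !(dotDl, dotDr, dotZl, dotZr) (dotC q g) sqr_enorm => h.
rewrite ler_pdivlMr ?mulr_gt0 //; nra.
Qed.

(* The new model dominates the convex combination, with weight th on the new cut,
   of that cut and the aggregate cut; th maximizes the resulting lower bound. *)
Lemma prox_gap_step t : (t < N)%N -> 0 <= prox_gap t <= G ^+ 2 / (2 * rho) ->
  prox_gap t.+1 <= prox_gap t
    - (1 - beta) ^+ 2 * rho / (8 * G ^+ 2) * prox_gap t ^+ 2.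
Proof.
move=> tN /andP[]; set a := prox_gap t => a0 aG.
have [b0 b1] := andP beta01.
pose p := z t.+1 - z 0%N; pose w := z t.+2 - z t.+1; pose g := gh (z t.+1).
have [pE wE gE] : [/\ z t.+1 - z 0%N = p, z t.+2 - z t.+1 = w & gh (z t.+1) = g].
  by [].
have zE : z t.+2 - z 0%N = w + p by rewrite /w /p addrA subrK.
have sE : dot (rho *: (z 0%N - z t.+1)) w = - (rho * dot p w).
  by rewrite -(opprB (z t.+1)) dotZl dotNl mulrN.
clearbody p w g.
pose th := (1 - beta) * a * rho / (4 * G ^+ 2).
have G2 : 0 < G ^+ 2 by rewrite exprn_gt0.
have th0 : 0 <= th.
  by rewrite divr_ge0 ?mulr_ge0 ?(ltW rho0) //; by [rewrite subr_ge0 ltW|exact: ltW].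
have th1 : th <= 1.
  rewrite ler_pdivrMr ?mulr_gt0 // mul1r.
  have : a * (2 * rho) <= G ^+ 2 by rewrite -ler_pdivlMr ?mulr_gt0.
  have : 0 <= beta * (a * rho) by rewrite !mulr_ge0 // ltW.
  nra.
(* The null-step test rearranged: at [z t.+1] the new cut lies above the old model by at least (1 -
   beta) times the predicted decrease. *)
have null : (1 - beta) * a <= fh (z t.+1) - F t (z t.+1).
  have := null_step _ tN; have : 0 <= rho / 2 * enorm p ^+ 2.
    by rewrite mulr_ge0 ?sqr_ge0 // divr_ge0 // ltW.
  rewrite /a /prox_gap pE; nra.
have gG : dot g g <= G ^+ 2.
  rewrite -gE -sqr_enorm lerXn2r ?nnegrE ?enorm_ge0 ?(ltW G0) // gh_le //.
  by case: (z_argmin _ (ltnW tN)).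
have pG : rho ^+ 2 * dot p p <= G ^+ 2.
  rewrite -sqr_enorm -exprMn lerXn2r ?nnegrE ?(ltW G0) ?mulr_ge0 ?enorm_ge0 ?(ltW rho0) //.
  by rewrite -pE aggregate_bound // ltnW.
have qG : dot (g + rho *: p) (g + rho *: p) <= 4 * G ^+ 2.
  have := dot_ge0 (g - rho *: p).
  by rewrite !(dotDl, dotDr, dotNl, dotNr, dotZl, dotZr) (dotC p g); nra.
(* Completing the square in w. The right side is what remains of the w-terms after weighting the
   cuts: the aggregate cancels the share 1 - th of rho p.w in the expanded quadratic. *)
have sq : - (th ^+ 2 * (2 * G ^+ 2) / rho)
    <= th * (dot g w + rho * dot p w) + rho / 2 * dot w w.
  have := dot_ge0 (th *: (g + rho *: p) + rho *: w).
  move: (g + rho *: p) qG (dotDl g (rho *: p) w) => q qG; rewrite dotZl => <-.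
  rewrite !(dotDl, dotDr, dotZl, dotZr) (dotC w q) => h.
  rewrite -mulNr ler_pdivrMr //.
  have : th ^+ 2 * dot q q <= th ^+ 2 * (4 * G ^+ 2) by rewrite ler_wpM2l ?sqr_ge0.
  nra.
have cut := F_cut t (z t.+2) tN; have agg := F_aggregate t (z t.+2) tN.
rewrite wE gE in cut; rewrite wE sE in agg.
have -> : prox_gap t.+1 = fh (z 0%N) -
   (F t.+1 (z t.+2) + rho / 2 * (dot w w + 2 * dot p w + dot p p)).
  by rewrite /prox_gap zE sqr_enorm !(dotDl, dotDr) (dotC w p); ring.
have aE : a = fh (z 0%N) - (F t (z t.+1) + rho / 2 * dot p p).
  by rewrite /a /prox_gap pE sqr_enorm.
have -> : (1 - beta) ^+ 2 * rho / (8 * G ^+ 2) * a ^+ 2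
  = th * ((1 - beta) * a) - th ^+ 2 * (2 * G ^+ 2) / rho.
  by rewrite /th; field; rewrite !gt_eqF.
have h1 := ler_wpM2l th0 null; have h2 := ler_wpM2l th0 cut.
have th1' : 0 <= 1 - th by rewrite subr_ge0.
have h3 := ler_wpM2l th1' agg.
move: sq; set B := th ^+ 2 * _ / _ => sq; nra.
Qed.

(** The inverse of [prox_gap] starts at or above 2 rho / G^2, gains c at each null step and ends at
    or below 1/Dl; solving for N gives the bound. *)
Lemma null_steps_bound (Dl : R) :
  0 < Dl -> (forall t, (t <= N)%N -> Dl <= prox_gap t) ->
  N%:R <= 16 / (1 - beta) ^+ 2 * (G ^+ 2 / (2 * rho * Dl) - 1).
Proof.
move=> Dl0 lb; have [b0 b1] := andP beta01.
pose c := (1 - beta) ^+ 2 * rho / (8 * G ^+ 2).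
have pos t : (t <= N)%N -> 0 < prox_gap t by move=> /lb; exact: lt_le_trans.
have b2 : 0 < (1 - beta) ^+ 2 by rewrite exprn_gt0 // subr_gt0.
have G2 : 0 < G ^+ 2 by rewrite exprn_gt0.
have c0 : 0 < c by rewrite divr_gt0 // mulr_gt0.
(* The upper bound has to hold at every t, as it keeps the weight th of the new cut at most 1; each
   step preserves it by not increasing the gap. *)
have up t : (t <= N)%N -> prox_gap t <= G ^+ 2 / (2 * rho).
  elim: t => [_|t ih tN]; first exact: prox_gap0_le.
  apply: le_trans (ih (ltnW tN)).
  apply: le_trans (prox_gap_step _ tN _) _; first by rewrite ih ?ltW ?pos // ltnW.
  by rewrite gerBl mulr_ge0 ?sqr_ge0 // ltW.
have dec t : (t < N)%N -> prox_gap t.+1 <= prox_gap t - c * prox_gap t ^+ 2.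
  by move=> tN; apply: prox_gap_step => //; rewrite up ?ltW ?pos // ltnW.
have h := inv_ge_quadratic_decrease _ _ _ _ (ltW c0) pos dec.
have lbN : (prox_gap N)^-1 <= Dl^-1 by rewrite lef_pV2 ?posrE ?pos // lb.
have ub0 : (G ^+ 2 / (2 * rho))^-1 <= (prox_gap 0)^-1.
  by rewrite lef_pV2 ?posrE ?pos ?up // divr_gt0 // mulr_gt0.
have : N%:R <= (Dl^-1 - (G ^+ 2 / (2 * rho))^-1) / c.
  by rewrite ler_pdivlMr // mulrC; lra.
move=> /le_trans; apply; rewrite le_eqVlt; apply/orP; left; apply/eqP.
by rewrite /c; field; rewrite !gt_eqF // subr_gt0.
Qed.

End NullSteps.

(** * Counting from the gap recursions *)

Lemma contraction_iter (R : realType) (h : nat -> R) (q : R) (a b : nat) :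
  0 <= q -> (forall j, (a <= j < b)%N -> h j.+1 <= q * h j) ->
  forall i, (a + i <= b)%N -> h (a + i)%N <= q ^+ i * h a.
Proof.
move=> q0 dec; elim=> [|i ih] ib; first by rewrite addn0 expr0 mul1r.
rewrite addnS in ib *; apply: le_trans (dec _ _) _; first by rewrite leq_addr.
by rewrite exprS -mulrA ler_wpM2l // ih // ltnW.
Qed.

(** Read backwards, the terms 1/h j decay geometrically from the last one, so the sum is at most
    1/(1 - q) times the last term. *)
Lemma sum_inv_contraction (R : realType) (h : nat -> R) (q : R) (a b : nat) :
  0 <= q < 1 -> (forall j, (a <= j <= b)%N -> 0 < h j) ->
  (forall j, (a <= j < b)%N -> h j.+1 <= q * h j) -> (a <= b)%N ->
  \sum_(a <= j < b.+1) (h j)^-1 <= ((1 - q) * h b)^-1.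
Proof.
case/andP=> q0 q1; elim: b => [|b ih] pos dec ab.
  move: ab pos; rewrite leqn0 => /eqP -> pos.
  have p := pos 0%N (leqnn _); rewrite big_nat1 lef_pV2 ?posrE //.
    by rewrite ger_pMl // gerBl.
  by rewrite mulr_gt0 // subr_gt0.
rewrite big_nat_recr //=.
have p1 : 0 < h b.+1 by rewrite pos // ab leqnn.
have q1' : 0 < 1 - q by rewrite subr_gt0.
move: ab; rewrite leq_eqVlt => /orP[/eqP ->|ab].
  rewrite big_geq // add0r lef_pV2 ?posrE ?mulr_gt0 //.
  by rewrite ger_pMl // gerBl.
have p : 0 < h b by rewrite pos // -ltnS ab leqnSn.
have ih' : \sum_(a <= j < b.+1) (h j)^-1 <= ((1 - q) * h b)^-1.
  apply: ih => // j /andP[aj jb]; first by rewrite pos // aj leqW.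
  by rewrite dec // aj ltnW.
have d : h b.+1 <= q * h b by rewrite dec // -ltnS ab leqnn.
apply: le_trans (lerD ih' (lexx _)) _.
have -> : ((1 - q) * h b.+1)^-1 =
    (h b.+1)^-1 + q / ((1 - q) * h b.+1).
  by field; rewrite !gt_eqF.
rewrite addrC lerD2l !invfM mulrCA ler_pM2l ?invr_gt0 //.
by rewrite ler_pdivlMr // mulrC ler_pdivrMr.
Qed.

Section Counting.
Context {R : realType}.
Variables (beta v e mu G : R) (g : nat -> R) (K : nat).
Hypotheses (beta01 : 0 < beta < 1) (v01 : 0 < v < 1) (e0 : 0 < e).
Hypotheses (mu0 : 0 < mu) (G0 : 0 < G).

(** At index N - 1 the gap is still above thr after N - 1 decrements, so N - 1 is strictly below the
    quotient and N is at most its ceiling. The maximum with 1 covers N = 0. *)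
Lemma linear_decrease_count thr N :
  (forall j, (j < N)%N -> thr < g j /\ g j.+1 <= g j - (v^-1 - 1) * e) ->
  N%:Z <= stage_count v (g 0%N) thr e - 1.
Proof.
move=> dec; have c0 : 0 < (v^-1 - 1) * e.
  by case/andP: v01 => ? ?; rewrite mulr_gt0 // subr_gt0 invf_gt1.
rewrite /stage_count; set y := _ / _; rewrite lerBrDr.
case: N dec => [|N] dec; first by rewrite add0r le_max lexx.
have gN i : (i <= N.+1)%N -> g i <= g 0%N - i%:R * ((v^-1 - 1) * e).
  elim: i => [_|i ih iN]; first by rewrite mul0r subr0.
  have [_ /le_trans] := dec i iN; apply; have := ih (ltnW iN).
  by rewrite -natr1; lra.
have : N%:R < y.
  rewrite ltr_pdivlMr //; have [h _] := dec N (leqnn _).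
  by have := gN N (leqnSn _); lra.
rewrite le_max => h; apply/orP; right; rewrite lerD2r.
have := lt_le_trans h (ceil_ge y); rewrite -[N%:R]/((N%:Z)%:~R) ltr_int.
by rewrite intS addrC lezD1.
Qed.

Lemma stage_count_le gap thr thr' : thr <= thr' ->
  stage_count v gap thr' e <= stage_count v gap thr e.
Proof.
move=> h; rewrite /stage_count ge_max le_max lexx /= le_max; apply/orP; right.
rewrite lerD2r; apply: ceil_le; rewrite ler_wpM2r // ?lerD2l ?lerN2 //.
case/andP: v01 => ? ?.
by rewrite invr_ge0 ltW // mulr_gt0 // subr_gt0 invf_gt1.
Qed.

Lemma stage_count1 gap thr : gap <= thr -> stage_count v gap thr e = 1.
Proof.
move=> h; rewrite /stage_count max_l // -lerBrDr subrr ceil_le0 //.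
rewrite pmulr_lle0 ?subr_le0 //; case/andP: v01 => ? ?.
by rewrite invr_gt0 mulr_gt0 // subr_gt0 invf_gt1.
Qed.

Variable Tn : nat -> nat.
Hypothesis not_accurate : forall j, (j < K)%N -> 4 * e / beta < g j.
Hypothesis far_step : forall j, (j < K)%N -> 2 * e / (beta * v) < g j ->
  g j.+1 <= g j - (v^-1 - 1) * e.
Hypothesis near_step : forall j, (j < K)%N -> g j <= 2 * e / (beta * v) ->
  g j.+1 <= (1 - beta / 2) * g j + e.

(** The threshold t = 2 e / (beta v) is not recrossed: a near step leads to at most (1 - beta/2) t +
    e = t - e/v + e, which is below t as v < 1. *)
Lemma regimes : exists2 K1, (K1 <= K)%N &
  (forall j, (j < K1)%N -> 2 * e / (beta * v) < g j) /\
  (forall j, (K1 <= j < K)%N -> g j <= 2 * e / (beta * v)).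
Proof.
have [/andP[b0 b1] /andP[v0 v1]] := (beta01, v01).
pose P i := (i == K) || (g i <= 2 * e / (beta * v)).
have exP : exists i, P i by exists K; rewrite /P eqxx.
case: (ex_minnP exP) => K1 PK1 K1min; exists K1.
  by apply: K1min; rewrite /P eqxx.
split=> [j jK1|j].
  by rewrite ltNge; apply: contraL jK1 => h; rewrite -leqNgt K1min // /P h orbT.
elim: j => [|j ih] /andP[K1j jK].
  by move: K1j PK1; rewrite leqn0 => /eqP ->; rewrite /P (ltn_eqF jK).
move: K1j; rewrite leq_eqVlt => /orP[/eqP K1j|K1j].
  by move: PK1; rewrite /P K1j (ltn_eqF jK).
have gj : g j <= 2 * e / (beta * v) by rewrite ih // -ltnS K1j ltnW.
apply: (le_trans (near_step _ (ltnW jK) gj)).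
have : (1 - beta / 2) * g j <= (1 - beta / 2) * (2 * e / (beta * v)).
  by apply: ler_wpM2l => //; lra.
have -> : (1 - beta / 2) * (2 * e / (beta * v)) = 2 * e / (beta * v) - e / v.
  by field; rewrite !gt_eqF.
have : e <= e / v by rewrite ler_peMr ?invf_ge1 // ltW.
lra.
Qed.

(** The value 2 e / beta is the fixed point of the near recursion, and the factor 1/2 makes [D] a
    lower bound on the predicted decrease in near iterations. *)
Let D j := (g j - 2 * e / beta) / 2.

Lemma near_excess_step j : (j < K)%N -> g j <= 2 * e / (beta * v) ->
  D j.+1 <= (1 - beta / 2) * D j.
Proof.
move=> jK /(near_step _ jK); rewrite /D; case/andP: beta01 => b0 b1.
have -> : (1 - beta / 2) * ((g j - 2 * e / beta) / 2) =
  ((1 - beta / 2) * g j + e - 2 * e / beta) / 2 by field; rewrite gt_eqF.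
by move=> h; rewrite ler_pM2r ?invr_gt0 // lerD2r.
Qed.

Lemma excess_gt j : (j < K)%N -> e / beta < D j.
Proof. by move=> /not_accurate; rewrite /D -!mulrA; lra. Qed.

(** For v >= 1/2 the near threshold is at most 4 e / beta, so every inaccurate iteration is far.
    Otherwise far iterations come first and contraction limits the near ones. *)
Lemma outer_count : K%:Z <= K_SC beta v (g 0%N) e.
Proof.
have [/andP[b0 b1] /andP[v0 v1]] := (beta01, v01).
rewrite /K_SC; have [hv|hv] := lerP (2^-1) v.
  suff : K%:Z <= stage_count v (g 0%N) (4 * e / beta) e - 1.
    by move=> /le_trans; apply; rewrite gerBl.
  apply: linear_decrease_count => j jK; split; first exact: not_accurate.
  apply: far_step => //; apply: le_lt_trans (not_accurate _ jK).
  rewrite ler_pdivrMr ?mulr_gt0 //.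
  have -> : 4 * e / beta * (beta * v) = 4 * e * v by field; rewrite gt_eqF.
  by have := ler_wpM2l (ltW e0) hv; lra.
have [K1 K1K [far near]] := regimes.
have thr_le : 4 * e / beta <= 2 * e / (beta * v).
  rewrite ler_pdivlMr ?mulr_gt0 //.
  have -> : 4 * e / beta * (beta * v) = 4 * e * v by field; rewrite gt_eqF.
  by have := ler_wpM2l (ltW e0) (ltW hv); lra.
have cK1 : K1%:Z <= stage_count v (g 0%N) (4 * e / beta) e - 1.
  apply: (@le_trans _ _ (stage_count v (g 0%N) (2 * e / (beta * v)) e - 1)).
    apply: linear_decrease_count => j jK1; split; first exact: far.
    by apply: far_step; [exact: leq_trans K1K|exact: far].
  by rewrite lerD2r stage_count_le.
set L := - log_base _ _.
have lnq : ln (1 - beta / 2) < 0 by apply: ln_lt0; apply/andP; split; lra.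
have vi : 1 <= v^-1 - 1.
  have : 2 < v^-1 by rewrite -[2]invrK ltf_pV2 // posrE ?invr_gt0.
  lra.
have L0 : 0 <= L.
  rewrite /L /log_base oppr_ge0 mulr_ge0_le0 ?ln_ge0 //.
  by rewrite invr_le0 ltW.
have cL0 : 0 <= Num.ceil L by rewrite ceil_ge0 (lt_le_trans _ L0) // ltrN10.
have [M KE] : exists M, K = (K1 + M)%N by exists (K - K1)%N; rewrite subnKC.
case: M KE => [|M] KE.
  rewrite KE addn0; apply: (le_trans cK1).
  by rewrite -addrA lerD2l (@le_trans _ _ 0) // addr_ge0.
(* Here M is one less than the number of near iterations. Inaccuracy at K1 + M and contraction from
   K1 give e/beta < q^M (e/beta)(1/v - 1) with q = 1 - beta/2; since ln q < 0, taking logarithms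
   yields M < L. *)
suff : M%:R < L.
  move=> h; have := lt_le_trans h (ceil_ge L).
  rewrite -[M%:R]/((M%:Z)%:~R) ltr_int -lezD1 => hM.
  rewrite KE PoszD intS -addrA lerD //.
    by apply: (le_trans cK1); rewrite gerBl.
  by rewrite [leLHS]addrC; apply: (le_trans hM); rewrite lerDl.
have hK1 : (K1 < K)%N by rewrite KE addnS ltnS leq_addr.
have hM : (K1 + M < K)%N by rewrite KE addnS.
have q0 : 0 < 1 - beta / 2 by lra.
have := contraction_iter _ D _ K1 K (ltW q0) _ M (ltnW hM).
have -> : (forall j, (K1 <= j < K)%N -> D j.+1 <= (1 - beta / 2) * D j) = True.
  apply/propext; split=> // _ j jK; apply: near_excess_step (near _ jK).
  by case/andP: jK.
move=> /(_ I) hD.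
have DK1 : D K1 <= e / beta * (v^-1 - 1).
  have := near K1; rewrite leqnn hK1 => /(_ isT).
  have -> : 2 * e / (beta * v) = 2 * (e / beta * v^-1) by field; rewrite !gt_eqF.
  rewrite /D -[2 * e / beta]mulrA; move: (e / beta) => q; lra.
have : 1 < (1 - beta / 2) ^+ M * (v^-1 - 1).
  have eb : 0 < e / beta by rewrite divr_gt0.
  rewrite -(ltr_pM2l eb) mulr1 mulrCA; apply: lt_le_trans (excess_gt _ hM) _.
  by apply: (le_trans hD); rewrite ler_wpM2l // exprn_ge0 // ltW.
have qM : 0 < (1 - beta / 2) ^+ M by rewrite exprn_gt0.
have vi0 : 0 < v^-1 - 1 by lra.
move=> h; have : 0 < ln ((1 - beta / 2) ^+ M * (v^-1 - 1)) by apply: ln_gt0.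
rewrite lnM ?posrE // lnXn // -[ln _ *+ M]mulr_natl => h2.
by rewrite /L /log_base -mulNr ltr_ndivlMr //; lra.
Qed.

Hypothesis far_steps : forall j, (j < K)%N -> 2 * e / (beta * v) < g j ->
  (Tn j)%:R <= 16 / (1 - beta) ^+ 2 * (G ^+ 2 / ((1 - v) * mu ^+ 2) - 1) + 1.
Hypothesis near_steps : forall j, (j < K)%N -> g j <= 2 * e / (beta * v) ->
  (Tn j)%:R <= 16 * G ^+ 2 * e / (beta * mu ^+ 2 * v * (1 - beta) ^+ 2) / D j
               - 15 / (1 - beta) ^+ 2.
Hypothesis slope : (0 < K)%N -> mu <= 2 * G.

(** The threshold thr is left free because the two ranges of v count far iterations against
    different thresholds. *)
Lemma far_steps_sum thr K1 : (K1 <= K)%N -> (0 < K1)%N ->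
  (forall j, (j < K1)%N -> 2 * e / (beta * v) < g j /\ thr < g j) ->
  (\sum_(0 <= j < K1) Tn j)%:R
    <= (stage_count v (g 0%N) thr e * steps_per_outer beta mu G v)%:~R :> R.
Proof.
move=> K1K K1_gt0 far; set s := steps_per_outer _ _ _ _.
have Ts j : (j < K1)%N -> (Tn j)%:R <= s%:~R :> R.
  move=> jK1; rewrite /s /steps_per_outer intrD.
  apply: le_trans (far_steps _ (leq_trans jK1 K1K) (far _ jK1).1) _.
  by rewrite lerD2r ceil_ge.
(* The formula for s alone may be negative; an actual far iteration, available since K1 > 0,
   excludes this. *)
have s0 : 0 <= s%:~R :> R by apply: le_trans (Ts _ K1_gt0); exact: ler0n.
have cK1 : K1%:Z <= stage_count v (g 0%N) thr e.
  suff : K1%:Z <= stage_count v (g 0%N) thr e - 1.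
    by move=> /le_trans; apply; rewrite gerBl.
  apply: linear_decrease_count => j jK1; split; first exact: (far _ jK1).2.
  by apply: far_step; [exact: leq_trans K1K|exact: (far _ jK1).1].
rewrite natr_sum intrM.
apply: (@le_trans _ _ (\sum_(0 <= j < K1) s%:~R)).
  by apply: ler_sum_nat => j /andP[_ jK1]; exact: Ts.
rewrite sumr_const_nat subn0 -mulr_natl ler_wpM2r //.
by rewrite -[K1%:R]/((K1%:Z)%:~R) ler_int.
Qed.

(** The sum of 1/D is governed by its last term, where D > e / beta. The negative constant of one
    near iteration is retained as slack for [inner_count]. *)
Lemma near_steps_sum K1 : (K1 < K)%N ->
  (forall j, (K1 <= j < K)%N -> g j <= 2 * e / (beta * v)) ->
  (\sum_(K1 <= j < K) Tn j)%:R
    <= 32 * G ^+ 2 / (mu ^+ 2 * v * beta * (1 - beta) ^+ 2)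
       - 15 / (1 - beta) ^+ 2.
Proof.
have [/andP[b0 b1] /andP[v0 v1]] := (beta01, v01).
move=> K1K near; set C := 16 * G ^+ 2 * e / (beta * mu ^+ 2 * v * (1 - beta) ^+ 2).
have b2 : 0 < (1 - beta) ^+ 2 by rewrite exprn_gt0 // subr_gt0.
have G2 : 0 < G ^+ 2 by rewrite exprn_gt0.
have mu2 : 0 < mu ^+ 2 by rewrite exprn_gt0.
have C0 : 0 < C by rewrite divr_gt0 // !mulr_gt0 // subr_gt0.
have Dp j : (j < K)%N -> 0 < D j.
  by move=> /excess_gt; apply: lt_trans; rewrite divr_gt0.
rewrite natr_sum.
apply: (@le_trans _ _ (\sum_(K1 <= j < K) (C / D j - 15 / (1 - beta) ^+ 2))).
  by apply: ler_sum_nat => j jK; apply: near_steps (near _ jK); case/andP: jK.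
rewrite sumrB sumr_const_nat -mulr_sumr lerB //; last first.
  rewrite -[leRHS]mulr_natl ler_peMl ?ler1n ?subn_gt0 //.
  by rewrite divr_ge0 // ltW.
have -> : 32 * G ^+ 2 / (mu ^+ 2 * v * beta * (1 - beta) ^+ 2) = C * (2 / e).
  by rewrite /C; field; rewrite !gt_eqF // subr_gt0.
rewrite ler_pM2l //.
case: K K1K near Dp excess_gt near_excess_step => // K' K1K near Dp big step.
apply: le_trans (sum_inv_contraction _ D (1 - beta / 2) K1 K' _ _ _ K1K) _.
- by apply/andP; split; lra.
- by move=> j /andP[_ jK]; exact: Dp.
- move=> j /andP[K1j jK]; apply: step; first exact: ltnW.
  by apply: near; rewrite K1j ltnW.
have := big K' (leqnn _) => h.
have -> : 2 / e = (beta / 2 * (e / beta))^-1 by field; rewrite !gt_eqF.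
have b4 : 0 < beta / 2 by rewrite divr_gt0.
have eb : 0 < e / beta by rewrite divr_gt0.
rewrite opprB addrCA subrr addr0 lef_pV2 ?posrE.
- by rewrite ler_pM2l // ltW.
- by rewrite pmulr_rgt0 // Dp.
- by rewrite pmulr_rgt0.
Qed.

(** The sum is split at the change of regime. The maximum with 0 serves K = 0, where the sum is
    empty but the formula may be negative. *)
Lemma inner_count :
  (\sum_(j < K) Tn j)%:R <= Num.max 0 (inner_bound beta mu G v (g 0%N) e).
Proof.
have [/andP[b0 b1] /andP[v0 v1]] := (beta01, v01).
rewrite -(big_mkord xpredT) le_max.
have [K0|K_gt0] := posnP K; first by rewrite K0 big_geq ?lexx.
apply/orP; right; rewrite /inner_bound; have [hv|hv] := lerP (2^-1) v.
  apply: far_steps_sum => // j jK; split; last exact: not_accurate.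
  apply: le_lt_trans (not_accurate _ jK).
  rewrite ler_pdivrMr ?mulr_gt0 //.
  have -> : 4 * e / beta * (beta * v) = 4 * e * v by field; rewrite gt_eqF.
  by have := ler_wpM2l (ltW e0) hv; lra.
have [K1 K1K [far near]] := regimes.
have b2 : 0 < (1 - beta) ^+ 2 by rewrite exprn_gt0 // subr_gt0.
have b2' : (1 - beta) ^+ 2 <= 1 by rewrite exprn_ile1 // ?subr_ge0 ?gerBl ltW.
have E0 : 0 <= 32 * G ^+ 2 / (mu ^+ 2 * v * beta * (1 - beta) ^+ 2).
  by apply/ltW/divr_gt0; rewrite !mulr_gt0 // subr_gt0.
have i15 : 0 <= 15 / (1 - beta) ^+ 2 by rewrite divr_ge0 // ltW.
rewrite (big_cat_nat (leq0n K1) K1K) /= natrD.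
have near_le : (\sum_(K1 <= j < K) Tn j)%:R
    <= 32 * G ^+ 2 / (mu ^+ 2 * v * beta * (1 - beta) ^+ 2).
  move: K1K; rewrite leq_eqVlt => /orP[/eqP ->|K1K]; first by rewrite big_geq.
  by apply: le_trans (near_steps_sum _ K1K near) _; rewrite gerBl.
have [K10|K1_gt0] := posnP K1; last first.
  apply: lerD near_le; apply: far_steps_sum => // j jK1.
  by split; exact: far.
(* Without a far iteration steps_per_outer may be negative; the slack
   15 / (1 - beta)^2 of the near iterations compensates for it. *)
rewrite {K1K far near_le}K10 in near *; rewrite big_geq // add0r.
have -> : stage_count v (g 0%N) (2 * e / (beta * v)) e = 1.
  by apply: stage_count1; exact: near.
rewrite mul1r; apply: le_trans (near_steps_sum _ K_gt0 near) _.
rewrite addrC lerD2r /steps_per_outer intrD.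
set B := 16 / _ * _; suff : - (15 / (1 - beta) ^+ 2) <= B + 1.
  by move=> /le_trans; apply; rewrite lerD2r ceil_ge.
(* From mu <= 2 G and 1 - v < 1. Then B >= -12 / (1 - beta)^2, which the slack covers. *)
have ratio : 1 / 4 <= G ^+ 2 / ((1 - v) * mu ^+ 2).
  rewrite ler_pdivlMr ?mulr_gt0 ?subr_gt0 ?exprn_gt0 //.
  have : mu ^+ 2 <= (2 * G) ^+ 2.
    by rewrite lerXn2r ?nnegrE ?slope // ?mulr_ge0 // ltW.
  have : 0 <= mu ^+ 2 by exact: sqr_ge0.
  rewrite exprMn; nra.
have ib : 0 < ((1 - beta) ^+ 2)^-1 by rewrite invr_gt0.
rewrite /B; move: (G ^+ 2 / _) ((1 - beta) ^+ 2)^-1 ratio ib => r i ratio ib.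
by nra.
Qed.

End Counting.

(** * Decrease under sharpness *)

Lemma convex_function_segment (R : realType) (E : lmodType R)
    (A : set (convex_lmodType E)) (f : E -> R) (y w : E) (s : R) :
  convex_function A f -> A y -> A w -> 0 <= s <= 1 ->
  f (y + s *: (w - y)) <= (1 - s) * f y + s * f w.
Proof.
move=> fc yA wA /andP[s0 s1].
have := fc (Itv01 s0 s1) w y; rewrite !inE => /(_ wA yA).
rewrite convRE /= [leRHS]addrC; congr (f _ <= _).
by rewrite /conv /= scalerBr scalerBl scale1r addrC addrA -addrA addrAC addrA.
Qed.

Lemma feasible_segment (R : realType) (Xi : Type) (n m r l : nat)
    (pb : tsslp R Xi n m r l) y w (s : R) :
  feasible pb y -> feasible pb w -> 0 <= s <= 1 ->
  feasible pb (y + s *: (w - y)).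
Proof.
move=> [Ay y0] [Aw w0] /andP[s0 s1]; split.
  by rewrite mulmxDr -scalemxAr mulmxBr Ay Aw subrr scaler0 addr0.
move=> i; have := y0 i; have := w0 i; rewrite !mxE => wi yi.
have -> : y i 0 + s * (w i 0 - y i 0) = (1 - s) * y i 0 + s * w i 0 by ring.
by rewrite addr_ge0 // mulr_ge0 // subr_ge0.
Qed.

Section SharpDescent.
Context {R : realType} {n : nat}.
Variables (X : set 'cV[R]_n) (f fh Fm : 'cV[R]_n -> R) (x0 x1 : 'cV[R]_n).
Variables (fstar eps1 eps2 mu rho : R).
Hypotheses (mu0 : 0 < mu) (rho0 : 0 < rho) (x0X : X x0).
Hypothesis X_convex : forall y w s, X y -> X w -> 0 <= s <= 1 ->
  X (y + s *: (w - y)).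
Hypothesis f_convex : forall y w s, X y -> X w -> 0 <= s <= 1 ->
  f (y + s *: (w - y)) <= (1 - s) * f y + s * f w.
Hypothesis f_min : is_min [set f y | y in X] fstar.
Hypothesis f_sharp : mu * dist_to x0 [set y | X y /\ f y = fstar] <= f x0 - fstar.
Hypothesis fh_accurate : forall y, X y -> f y - eps1 <= fh y <= f y + eps2.

Let g := f x0 - fstar.

Lemma gap_ge0 : 0 <= g.
Proof. by rewrite subr_ge0; case: f_min => _; apply; exists x0. Qed.

(* The distance is an infimum; this form avoids showing that it is attained. *)
Lemma le_sharp_dist A B : 0 < B ->
  (forall y, X y -> f y = fstar -> A <= B * enorm (x0 - y)) -> A <= B * (g / mu).
Proof.
move=> B0 AB; rewrite -ler_pdivrMl // ler_pdivlMr // mulrC.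
apply: le_trans f_sharp; rewrite ler_pM2l //; apply: lb_le_inf.
  by have [[y yX yf] _] := f_min; exists (enorm (x0 - y)), y.
by move=> _ [y [yX yf] <-]; rewrite ler_pdivrMl // AB.
Qed.

(** The subgradient inequality at a solution y gives fh x0 - fh y <= G |x0 - y|, and the estimation
    errors cost eps1 + eps2. This serves to compare mu with G. *)
Lemma sharp_slope (gx : 'cV[R]_n) (G : R) : 0 < G -> enorm gx <= G ->
  (forall y, X y -> fh x0 + dot gx (y - x0) <= fh y) ->
  g - (eps1 + eps2) <= G * (g / mu).
Proof.
move=> G0 gG sub; apply: le_sharp_dist => // y yX yf.
have /andP[_ h1] := fh_accurate _ yX; have /andP[h2 _] := fh_accurate _ x0X.
have : dot gx (x0 - y) <= G * enorm (x0 - y).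
  by apply: le_trans (dot_le_enorm _ _) _; rewrite ler_wpM2r // enorm_ge0.
have := sub y yX; rewrite -(opprB x0 y) dotNr /g; lra.
Qed.

Hypothesis Fm_le : forall y, X y -> Fm y <= fh y.
Hypothesis x1_argmin :
  is_argmin X (fun y => Fm y + rho / 2 * enorm (y - x0) ^+ 2) x1.

(** At w = x0 + s (y - x0), with y a solution, the estimation error is eps2 at w and eps1 at the
    center, and the quadratic term is rho/2 s^2 |x0 - y|^2, bounded by sharpness. *)
Lemma prox_gap_ge s : 0 < s <= 1 ->
  s * g - rho * s ^+ 2 * g ^+ 2 / (2 * mu ^+ 2) - (eps1 + eps2)
    <= fh x0 - (Fm x1 + rho / 2 * enorm (x1 - x0) ^+ 2).
Proof.
case/andP=> s0 s1; have s01 : 0 <= s <= 1 by rewrite ltW.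
set V := fh x0 - _; set c := rho / 2 * s ^+ 2.
have c0 : 0 < c by rewrite mulr_gt0 ?exprn_gt0 // divr_gt0.
have key y : X y -> f y = fstar ->
    s * g - (eps1 + eps2) - V <= c * enorm (x0 - y) ^+ 2.
  move=> yX yf; pose w := x0 + s *: (y - x0).
  have wX : X w by exact: X_convex.
  have h1 := x1_argmin.2 _ wX; have h2 := Fm_le _ wX.
  have /andP[_ h3] := fh_accurate _ wX; have /andP[h4 _] := fh_accurate _ x0X.
  have := f_convex _ _ _ x0X yX s01; rewrite -/w yf => h5.
  have wE : enorm (w - x0) ^+ 2 = s ^+ 2 * enorm (x0 - y) ^+ 2.
    by rewrite /w addrC addKr enormZ (enormBC x0) ger0_norm ?(ltW s0) // exprMn.
  move: h1 => /=; rewrite wE /V /g /c => h1; nra.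
have -> : rho * s ^+ 2 * g ^+ 2 / (2 * mu ^+ 2) = c * (g / mu) ^+ 2.
  by rewrite /c; field; rewrite gt_eqF.
suff : s * g - (eps1 + eps2) - V <= c * (g / mu) ^+ 2 by lra.
(* A bound linear in the distance is required by [le_sharp_dist], so the square root of A / c <= |x0
   - y|^2 is taken once A > 0. *)
set A := s * g - _ - V; have [A0|A0] := lerP A 0.
  by apply: (le_trans A0); rewrite mulr_ge0 ?sqr_ge0 // ltW.
have cA : 0 <= c^-1 * A by rewrite mulr_ge0 ?invr_ge0 // ltW.
have g0 : 0 <= g / mu by rewrite divr_ge0 ?gap_ge0 // ltW.
rewrite -ler_pdivrMl // -[leLHS]sqr_sqrtr // lerXn2r ?nnegrE ?sqrtr_ge0 //.
rewrite -[g / mu]mul1r; apply: le_sharp_dist => // y yX yf.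
rewrite mul1r -[leRHS]ger0_norm ?enorm_ge0 // -sqrtr_sqr ler_wsqrtr //.
by rewrite ler_pdivrMl // key.
Qed.

(** The error eps1 + eps2 enters with factor beta through the predicted decrease, and once more when
    fh is replaced by f at x0 and x1; dropping the proximal term is in the right direction. *)
Lemma serious_gap_le (beta s : R) : 0 < beta -> 0 < s <= 1 -> X x1 ->
  beta * (fh x0 - Fm x1) <= fh x0 - fh x1 ->
  f x1 - fstar <= g - beta * (s * g - rho * s ^+ 2 * g ^+ 2 / (2 * mu ^+ 2))
                  + (beta + 1) * (eps1 + eps2).
Proof.
move=> b0 s01 x1X h; have := prox_gap_ge _ s01; set a := s * g - _ => h1.
have /andP[h2 _] := fh_accurate _ x1X; have /andP[_ h3] := fh_accurate _ x0X.
have h4 : 0 <= rho / 2 * enorm (x1 - x0) ^+ 2.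
  by rewrite mulr_ge0 ?sqr_ge0 // divr_ge0 // ltW.
have h5 : beta * (a - (eps1 + eps2)) <= beta * (fh x0 - Fm x1).
  by rewrite ler_pM2l //; lra.
rewrite /g; lra.
Qed.

End SharpDescent.

(** * Asymptotics of the bounds *)

Section Asymptotics.
Context {R : realType}.

Lemma eqO_inv_at_right (h : R -> R) (A : R) :
  (forall e, 0 < e < 1 -> `|h e| <= A / e) ->
  h =O_ (0^'+) (fun e : R => e^-1).
Proof.
move=> hA; apply/eqO_exP; exists (`|A| + 1); first by rewrite ltr_wpDl.
near=> e; have e01 : 0 < e < 1.
  apply/andP; split; near: e; first exact: nbhs_right_gt.
  exact: nbhs_right_lt.
have ei : 0 <= e^-1 by rewrite invr_ge0 ltW //; case/andP: e01.
apply: le_trans (hA e e01) _; rewrite (ger0_norm ei) ler_wpM2r //.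
by apply: le_trans (ler_norm A) _; rewrite lerDl.
Unshelve. all: by end_near. Qed.

(** With thr proportional to e the quotient is at most a constant over e; ceiling, increment and
    maximum add at most 3, which is below 3/e. *)
Lemma stage_count_asymptotic (v gap a thr e : R) : 0 < v < 1 -> 0 < e < 1 ->
  thr = a * e ->
  `|(stage_count v gap thr e)%:~R| <= (3 + (`|gap| + `|a|) / (v^-1 - 1)) / e :> R.
Proof.
move=> /andP[v0 v1] /andP[e0 e1] ->.
have c0 : 0 < v^-1 - 1 by rewrite subr_gt0 invf_gt1.
have ei : 1 < e^-1 by rewrite invf_gt1.
rewrite /stage_count; set y := _ / _.
have yb : y <= (`|gap| + `|a|) / (v^-1 - 1) / e.
  rewrite /y invfM mulrA ler_pM2r ?invr_gt0 // ler_pM2r ?invr_gt0 //.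
  have := ler_norm gap; have := ler_norm (- a); rewrite normrN => h1 h2.
  have : - a * e <= `|a| by apply: le_trans (_ : `|a| * e <= _);
    [rewrite ler_pM2r|rewrite ler_piMr // ltW].
  lra.
have p : 0 <= (`|gap| + `|a|) / (v^-1 - 1) / e.
  by rewrite !divr_ge0 // ltW.
rewrite ger0_norm; last by rewrite ler0z (le_trans _ (_ : 1 <= _)) // le_max lexx.
rewrite mulrDl; have [_|_] := lerP (Num.ceil y + 1) 1; first by lra.
by rewrite intrD; have := ceilB1_lt y; rewrite intrB; lra.
Qed.

Lemma K_SC_asymptotic (beta v gap : R) : 0 < v < 1 ->
  (fun e : R => (K_SC beta v gap e)%:~R : R) =O_ (0^'+) (fun e : R => e^-1).
Proof.
move=> v01; pose c : R := (Num.ceil (- log_base (1 - beta / 2) (v^-1 - 1)))%:~R.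
apply: (@eqO_inv_at_right _
  (3 + (`|gap| + `|4 / beta|) / (v^-1 - 1) + (`|c| + 1))) => e e01.
have ei : 1 <= e^-1 by case/andP: e01 => e0 e1; rewrite invf_ge1 // ltW.
have aE : 4 * e / beta = 4 / beta * e by rewrite mulrAC.
have h := stage_count_asymptotic _ gap _ _ _ v01 e01 aE.
rewrite mulrDl /K_SC; case: ifP => _.
  apply: (le_trans h); rewrite lerDl mulr_ge0 ?addr_ge0 //.
  exact: le_trans ei.
rewrite !intrD -addrA -/c; apply: le_trans (ler_normD _ _) _; apply: lerD => //.
apply: le_trans (ler_normD _ _) _; rewrite normr1 ler_peMr // addr_ge0 //.
Qed.

Lemma inner_bound_asymptotic (beta mu G v gap : R) : 0 < v < 1 ->
  inner_bound beta mu G v gap =O_ (0^'+) (fun e : R => e^-1).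
Proof.
move=> v01; pose s : R := (steps_per_outer beta mu G v)%:~R.
pose E := 32 * G ^+ 2 / (mu ^+ 2 * v * beta * (1 - beta) ^+ 2).
pose a := if 2^-1 <= v then 4 / beta else 2 / (beta * v).
apply: (@eqO_inv_at_right _
  ((3 + (`|gap| + `|a|) / (v^-1 - 1)) * `|s| + `|E|)) => e e01.
have ei : 1 <= e^-1 by case/andP: e01 => e0 e1; rewrite invf_ge1 // ltW.
rewrite mulrDl [_ * `|s| / e]mulrAC /inner_bound /a; case: ifP => _.
  rewrite intrM normrM -[leLHS]addr0; apply: lerD.
    apply: ler_wpM2r => //; apply: stage_count_asymptotic => //.
    by rewrite mulrAC.
  by rewrite mulr_ge0 // (le_trans _ ei).
apply: le_trans (ler_normD _ _) _; apply: lerD; last by rewrite ler_peMr.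
rewrite intrM normrM; apply: ler_wpM2r => //.
by apply: stage_count_asymptotic => //; rewrite mulrAC.
Qed.

End Asymptotics.

(** * Runs of the algorithm *)

Section Run.
Context {R : realType} {d : measure_display} {Xi : measurableType d}.
Context {n m r l : nat}.
Variables (pb : tsslp R Xi n m r l) (f : 'cV[R]_n -> R) (fstar : R).
Variables (beta : R) (rho : nat -> R) (S : nat -> seq Xi).
Variables (U : 'cV[R]_n -> Xi -> 'cV[R]_r) (Jg Js : nat -> nat -> set nat).
Variables (x : nat -> nat -> 'cV[R]_n) (F : nat -> nat -> 'cV[R]_n -> R).
Variables (T : nat -> option nat) (eps1 eps2 G mu v : R).
Hypothesis f_convex :
  convex_function (feasible pb : set (convex_lmodType 'cV[R]_n)) f.
Hypothesis f_min : is_min [set f y | y in feasible pb] fstar.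
Hypothesis beta01 : 0 < beta < 1.
Hypothesis run : Lshaped_run pb beta rho S U Jg Js x F T.
Hypothesis f_approx : forall k, reached T k -> forall y, feasible pb y ->
  ((f y - eps1)%:E <= fhat pb (S k) y <= (f y + eps2)%:E)%E.
Hypothesis G0 : 0 < G.
Hypothesis ghat_le : forall k, reached T k -> forall y, feasible pb y ->
  enorm (ghat pb U (S k) y) <= G.
Hypothesis bundle : forall k t, reached T k -> ltT t.+1 (T k) ->
  [/\ convex_function [set: convex_lmodType 'cV[R]_n] (F k t.+1),
      forall y z, `|F k t.+1 y - F k t.+1 z| <= G * enorm (y - z)
    & forall y,
      ((F k t.+1 y)%:E <= fhat pb (S k) y)%E /\
      Num.max (gcut pb U (S k) (x k t.+1) y)
              (F k t (x k t.+1)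
               + dot (rho k *: (x k 0%N - x k t.+1)) (y - x k t.+1))
        <= F k t.+1 y].
Hypothesis mu0 : 0 < mu.
Hypothesis f_sharp : forall y, feasible pb y ->
  mu * dist_to y [set z | feasible pb z /\ f z = fstar] <= f y - fstar.

Let fh k y := fine (fhat pb (S k) y).
Let g k := f (x k 0%N) - fstar.
Let U_argmax k (hk : reached T k) := run_dual run hk.

Lemma reachedS k : reached T k.+1 -> reached T k.
Proof. by move=> hk j jk; apply: hk; exact: ltnW. Qed.

Lemma reached_lt k j : (j <= k)%N -> reached T k -> reached T j.
Proof. by move=> jk hk i ij; apply: hk; exact: leq_trans jk. Qed.

Lemma ltT_trans s t (N : option nat) : (s <= t)%N -> ltT t N -> ltT s N.
Proof. by case: N => // N; exact: leq_ltn_trans. Qed.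

Lemma outer_iterate_feasible k : reached T k -> feasible pb (x k 0%N).
Proof.
elim: k => [_|k ih hk]; first exact: run_init run.
have := run_length run (reachedS _ hk); have := hk k (leqnn _).
case Tk : (T k) => [s|] // _ [t [sE _ _ ->]].
rewrite sE; apply: (run_argmin run (reachedS _ hk) _).1.
by rewrite Tk /= sE.
Qed.

Lemma fhat_fin k y : reached T k -> feasible pb y ->
  fhat pb (S k) y = (fh k y)%:E.
Proof. by move=> hk yX; rewrite /fh (fhatE _ _ _ (U_argmax _ hk)). Qed.

Lemma fhat_accurate k y : reached T k -> feasible pb y ->
  f y - eps1 <= fh k y <= f y + eps2.
Proof. by move=> hk yX; have := f_approx _ hk _ yX; rewrite fhat_fin // !lee_fin. Qed.

(** The assumption on bundle functions starts at index 1. The initial model is a single cut, below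
    fh by duality; being affine with slope of norm at most G, it is also covered in the next two
    lemmas. *)
Lemma model_le k t y : reached T k -> ltT t (T k) -> feasible pb y ->
  F k t y <= fh k y.
Proof.
case: t => [|t] hk ht yX.
  rewrite (run_first_model run hk).
  exact: (gcut_le_fhat _ _ _ (U_argmax _ hk)) (outer_iterate_feasible _ hk) yX.
have [_ _ /(_ y) [h _]] := bundle _ _ hk ht.
by rewrite fhat_fin // lee_fin in h.
Qed.

Lemma model_convex k t y w s : reached T k -> ltT t (T k) -> 0 <= s <= 1 ->
  F k t (y + s *: (w - y)) <= (1 - s) * F k t y + s * F k t w.
Proof.
case: t => [|t] hk ht s01.
  rewrite !(run_first_model run hk) /gcut.
  by rewrite !(dotDr, dotNr, dotZr); lra.
have [Fc _ _] := bundle _ _ hk ht.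
exact: convex_function_segment Fc _ _ s01.
Qed.

Lemma model_lipschitz k t y w : reached T k -> ltT t (T k) ->
  F k t y - F k t w <= G * enorm (y - w).
Proof.
case: t => [|t] hk ht; last first.
  have [_ FL _] := bundle _ _ hk ht.
  exact: le_trans (ler_norm _) (FL _ _).
rewrite !(run_first_model run hk) /gcut opprD addrACA subrr add0r -dotBr.
rewrite opprB addrA subrK.
apply: le_trans (dot_le_enorm _ _) _; rewrite ler_wpM2r ?enorm_ge0 //.
by apply: ghat_le => //; exact: outer_iterate_feasible.
Qed.

(** The bound from sharpness holds for every model up to N, hence feeds [null_steps_bound]. Only
    steps before N are asked to be null, so terminating and endless inner loops are both covered. *)
Lemma null_steps_le k N s Dl : reached T k -> ltT N (T k) ->
  (forall t, (t < N)%N -> ~ serious pb beta S x F k t) ->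
  0 < s <= 1 -> 0 < Dl ->
  Dl <= s * g k - rho k * s ^+ 2 * g k ^+ 2 / (2 * mu ^+ 2) - (eps1 + eps2) ->
  N%:R <= 16 / (1 - beta) ^+ 2 * (G ^+ 2 / (2 * rho k * Dl) - 1).
Proof.
move=> hk hN null s01 Dl0 Dl_le.
have x0X := outer_iterate_feasible _ hk.
have lt t : (t <= N)%N -> ltT t (T k) by move=> /ltT_trans; apply.
have amin t : (t <= N)%N -> is_argmin (feasible pb)
    (fun z => F k t z + rho k / 2 * enorm (z - x k 0%N) ^+ 2) (x k t.+1).
  by move=> tN; exact (run_argmin run hk (lt _ tN)).
apply: (null_steps_bound (feasible pb) (fh k) (ghat pb U (S k)) (x k) (F k)) => //.
- exact: run_stepsize run k.
- exact: feasible_segment.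
- exact (run_first_model run hk).
- exact: ghat_le.
- by move=> t y w q tN; apply: model_convex => //; exact: lt.
- by move=> t y w tN; apply: model_lipschitz => //; exact: lt.
- move=> t y tN; have [_ _ /(_ y) [_]] := bundle _ _ hk (lt _ tN).
  by rewrite ge_max => /andP[].
- move=> t y tN; have [_ _ /(_ y) [_]] := bundle _ _ hk (lt _ tN).
  by rewrite ge_max => /andP[].
- by move=> t /null /negP; rewrite -ltNge.
move=> t tN; apply: (le_trans Dl_le).
apply: (prox_gap_ge (feasible pb) f (fh k) (F k t) _ _ fstar eps1 eps2 mu) => //.
- exact: run_stepsize run k.
- exact: feasible_segment.
- by move=> y w q yX wX q01; apply: convex_function_segment f_convex yX wX q01.
- exact: f_sharp.
- by move=> y; exact: fhat_accurate.
- by move=> y; apply: model_le => //; exact: lt.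
- exact: amin.
Qed.

Lemma outer_iteration k s Dl : reached T k -> 0 < s <= 1 -> 0 < Dl ->
  Dl <= s * g k - rho k * s ^+ 2 * g k ^+ 2 / (2 * mu ^+ 2) - (eps1 + eps2) ->
  exists N, [/\ T k = Some N.+1,
    N%:R <= 16 / (1 - beta) ^+ 2 * (G ^+ 2 / (2 * rho k * Dl) - 1)
  & g k.+1 <= g k - beta * (s * g k - rho k * s ^+ 2 * g k ^+ 2 / (2 * mu ^+ 2))
              + (beta + 1) * (eps1 + eps2)].
Proof.
move=> hk s01 Dl0 Dl_le; have := run_length run hk.
case Tk : (T k) => [N'|] => [[N [sE ser null xk]]|null]; last first.
  (* An endless inner loop would make the bound hold for every N, against the Archimedean
     property. *)
  set B := 16 / (1 - beta) ^+ 2 * (G ^+ 2 / (2 * rho k * Dl) - 1).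
  have h N : N%:R <= B.
    by apply: null_steps_le s01 Dl0 Dl_le => //; rewrite Tk.
  by have := archi_boundP (le_trans (ler0n _ 0) (h 0%N)); rewrite ltNge h.
rewrite {N'}sE in Tk xk *; have hN : ltT N (T k) by rewrite Tk /=.
exists N; split=> //; first exact: null_steps_le s01 Dl0 Dl_le.
have amin := run_argmin run hk hN; rewrite /g xk.
apply: (serious_gap_le (feasible pb) f (fh k) (F k N) _ _ fstar eps1 eps2 mu
  (rho k) _ _ _ _ _ f_min _ _ _ amin beta) => //.
- exact: run_stepsize run k.
- exact: outer_iterate_feasible.
- exact: feasible_segment.
- by move=> y w q yX wX q01; apply: convex_function_segment f_convex yX wX q01.
- by apply: f_sharp; exact: outer_iterate_feasible.
- by move=> y; exact: fhat_accurate.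
- by move=> y; exact: model_le.
- by case/andP: beta01.
- exact: amin.1.
Qed.

Variable eb : R.
Hypothesis ebE : eb = (beta + 1) * (eps1 + eps2).
Hypothesis eb0 : 0 < eb.
Hypothesis v01 : 0 < v < 1.
Hypothesis rhoE : forall k, rho k = beta * mu ^+ 2 * v / (2 * eb).

Lemma eps_le : eps1 + eps2 <= eb / beta.
Proof.
case/andP: beta01 => b0 b1; rewrite ler_pdivlMr // mulrC ebE mulrDl mul1r lerDl.
by apply: ltW; move: eb0; rewrite ebE pmulr_rgt0 // ltr_wpDl // ltW.
Qed.

(** Farness guarantees s <= 1. The predicted decrease is then at least (1 - v) eb / (beta v), and
    [eb] cancels in its product with rho, so the null-step bound does not depend on [eb]. *)
Lemma far_iteration k : reached T k -> 2 * eb / (beta * v) < g k ->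
  exists N, [/\ T k = Some N.+1,
    N%:R <= 16 / (1 - beta) ^+ 2 * (G ^+ 2 / ((1 - v) * mu ^+ 2) - 1)
  & g k.+1 <= g k - (v^-1 - 1) * eb].
Proof.
have [/andP[b0 b1] /andP[v0 v1]] := (beta01, v01).
move=> hk far; have thr0 : 0 < 2 * eb / (beta * v) by rewrite divr_gt0 ?mulr_gt0.
have g0 : 0 < g k by exact: lt_trans far.
have eb_n0 : eb != 0 by rewrite gt_eqF.
(* s = mu^2 / (rho g) *)
pose s := 2 * eb / (beta * v) / g k.
have sg : s * g k = 2 * eb / (beta * v) by rewrite /s divfK // gt_eqF.
have sE : s * g k - rho k * s ^+ 2 * g k ^+ 2 / (2 * mu ^+ 2) = eb / (beta * v).
  rewrite -[_ * g k ^+ 2]mulrA -exprMn sg rhoE; field.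
  by rewrite eb_n0 !gt_eqF.
pose Dl := (1 - v) * eb / (beta * v).
have Dl0 : 0 < Dl by rewrite divr_gt0 ?mulr_gt0 // subr_gt0.
have s01 : 0 < s <= 1.
  by rewrite divr_gt0 //= ler_pdivrMr // mul1r ltW.
have := outer_iteration k s Dl hk s01 Dl0.
rewrite sE => /(_ _)[|N [TN NN gN]].
  have -> : Dl = eb / (beta * v) - eb / beta by rewrite /Dl; field; rewrite !gt_eqF.
  by rewrite lerD2l lerN2 eps_le.
exists N; split=> //.
  have <- : 2 * rho k * Dl = (1 - v) * mu ^+ 2; last exact: NN.
  by rewrite rhoE /Dl; field; rewrite eb_n0 !gt_eqF.
apply: (le_trans gN); rewrite -ebE.
have -> : beta * (eb / (beta * v)) = v^-1 * eb by field; rewrite !gt_eqF.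
lra.
Qed.

(** With s = 1 and g <= mu^2 / rho the quadratic loss is at most g/2, so the predicted decrease is
    at least g/2 - eb/beta, which inaccuracy makes positive. *)
Lemma near_iteration k : reached T k -> 4 * eb / beta < g k ->
  g k <= 2 * eb / (beta * v) ->
  exists N, [/\ T k = Some N.+1,
    N.+1%:R <= 16 * G ^+ 2 * eb / (beta * mu ^+ 2 * v * (1 - beta) ^+ 2)
                / ((g k - 2 * eb / beta) / 2) - 15 / (1 - beta) ^+ 2
  & g k.+1 <= (1 - beta / 2) * g k + eb].
Proof.
have [/andP[b0 b1] /andP[v0 v1]] := (beta01, v01).
move=> hk big near; have q0 : 0 < eb / beta by rewrite divr_gt0.
have eb_n0 : eb != 0 by rewrite gt_eqF.
have g0 : 0 < g k by apply: lt_trans big; rewrite divr_gt0 ?mulr_gt0.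
pose Dl := (g k - 2 * eb / beta) / 2.
have Dl0 : 0 < Dl by move: big; rewrite /Dl -!mulrA; lra.
have half : 1 * g k - rho k * 1 ^+ 2 * g k ^+ 2 / (2 * mu ^+ 2) >= g k / 2.
  have -> : rho k * 1 ^+ 2 * g k ^+ 2 / (2 * mu ^+ 2)
      = g k * (g k * (beta * v) / (2 * eb)) / 2.
    by rewrite rhoE; field; rewrite eb_n0 !gt_eqF.
  have : g k * (beta * v) / (2 * eb) <= 1.
    by rewrite ler_pdivrMr ?mulr_gt0 // mul1r -ler_pdivlMr ?mulr_gt0.
  by rewrite -(ler_pM2l g0); lra.
have s01 : 0 < (1 : R) <= 1 by rewrite ltr01 lexx.
have := outer_iteration k 1 Dl hk s01 Dl0.
move: half; set a := 1 * g k - _ => half /(_ _)[|N [TN NN gN]].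
  by have := eps_le; rewrite /Dl -[2 * eb / beta]mulrA; lra.
exists N; split=> //; last first.
  apply: (le_trans gN); rewrite -ebE.
  by have := ler_wpM2l (ltW b0) half; lra.
(* The serious step counts 1 <= 1 / (1 - beta)^2, which turns the constant 16 into 15. *)
rewrite -natr1; have i1 : 1 <= ((1 - beta) ^+ 2)^-1.
  rewrite invf_ge1 ?exprn_gt0 ?subr_gt0 //.
  by rewrite exprn_ile1 ?subr_ge0 ?gerBl // ltW.
have E : 16 / (1 - beta) ^+ 2 * (G ^+ 2 / (2 * rho k * Dl) - 1) =
   16 * G ^+ 2 * eb / (beta * mu ^+ 2 * v * (1 - beta) ^+ 2) / Dl
   - 16 / (1 - beta) ^+ 2.
  rewrite rhoE; move: Dl Dl0 {NN} => D D0; field.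
  by rewrite eb_n0 !gt_eqF // subr_gt0.
rewrite E in NN; rewrite -/Dl; move: NN i1; set i := _^-1; lra.
Qed.

(** Inaccuracy gives eps1 + eps2 <= g/2, so [sharp_slope] yields g/2 <= G g / mu. *)
Lemma sharpness_le_lipschitz k : reached T k -> 4 * eb / beta < g k ->
  mu <= 2 * G.
Proof.
have /andP[b0 b1] := beta01.
move=> hk big; have x0X := outer_iterate_feasible _ hk.
have g0 : 0 < g k by apply: lt_trans big; rewrite divr_gt0 ?mulr_gt0.
have : g k - (eps1 + eps2) <= G * (g k / mu).
  apply: (sharp_slope (feasible pb) f (fh k) (x k 0%N) fstar eps1 eps2 mu _ _ _ _ _
    (ghat pb U (S k) (x k 0%N))) => //.
  - by apply: f_sharp.
  - by move=> y; exact: fhat_accurate.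
  - exact: ghat_le.
  - move=> y; exact: (gcut_le_fhat _ _ _ (U_argmax _ hk)).
rewrite mulrA ler_pdivlMr // => h.
have h2 : eps1 + eps2 <= g k / 2.
  by have := eps_le; have := divr_gt0 eb0 b0; move: big; rewrite -mulrA; lra.
have : g k * (mu / 2) <= g k * G.
  apply: le_trans (_ : (g k - (eps1 + eps2)) * mu <= _); last by rewrite [leRHS]mulrC.
  by rewrite mulrA mulrAC ler_pM2r //; lra.
by rewrite ler_pM2l // ler_pdivrMr // mulrC.
Qed.

End Run.

Theorem theorem3
  (R : realType) (d : measure_display) (Xi : measurableType d)
  (P : probability Xi R) (n m r l : nat) (pb : tsslp R Xi n m r l)
  (f : 'cV[R]_n -> R) (fstar : R)
  (* data of the algorithm and of its run *)
  (beta : R) (rho : nat -> R) (S : nat -> seq Xi)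
  (U : 'cV[R]_n -> Xi -> 'cV[R]_r) (Jg Js : nat -> nat -> set nat)
  (x : nat -> nat -> 'cV[R]_n) (F : nat -> nat -> 'cV[R]_n -> R)
  (T : nat -> option nat)
  (D eps1 eps2 G mu v : R)
  (* standing assumptions on the problem *)
  (hdata : measurable_data pb)
  (hf : forall y, feasible pb y -> objective pb P y = (f y)%:E)
  (hconv : convex_function (feasible pb : set (convex_lmodType 'cV[R]_n)) f)
  (hfstar : is_min [set f y | y in feasible pb] fstar)
  (* the run *)
  (hbeta : 0 < beta < 1)
  (hrun : Lshaped_run pb beta rho S U Jg Js x F T)
  (* (i) *)
  (hX0 : feasible pb !=set0)
  (hD : forall y z, feasible pb y -> feasible pb z -> enorm (y - z) <= D)
  (* (ii) *)
  (heps : forall k, reached T k -> forall y, feasible pb y ->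
     ((f y - eps1)%:E <= fhat pb (S k) y <= (f y + eps2)%:E)%E)
  (* (iii) *)
  (hG0 : 0 < G)
  (hG : forall k, reached T k -> forall y, feasible pb y ->
     enorm (ghat pb U (S k) y) <= G)
  (* (iv) *)
  (hbundle : forall k t, reached T k -> ltT t.+1 (T k) ->
     [/\ convex_function [set: convex_lmodType 'cV[R]_n] (F k t.+1),
         forall y z, `|F k t.+1 y - F k t.+1 z| <= G * enorm (y - z)
       & forall y,
         ((F k t.+1 y)%:E <= fhat pb (S k) y)%E /\
         Num.max (gcut pb U (S k) (x k t.+1) y)
                 (F k t (x k t.+1)
                  + dot (rho k *: (x k 0%N - x k t.+1)) (y - x k t.+1))
           <= F k t.+1 y])
  (* (v) *)
  (hmu0 : 0 < mu)
  (hsharp : forall y, feasible pb y ->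
     mu * dist_to y [set z | feasible pb z /\ f z = fstar] <= f y - fstar)
  (heb : 0 < (beta + 1) * (eps1 + eps2) < 1)
  (hv : 0 < v < 1)
  (hrho : forall k,
     rho k = beta * mu ^+ 2 * v / (2 * ((beta + 1) * (eps1 + eps2)))) :
  let eb := (beta + 1) * (eps1 + eps2) in
  let delta := 4 * eb / beta in
  let gap := f (x 0%N 0%N) - fstar in
  [/\ (* k is the first outer iteration with a delta-accurate point; Num.max 0
         only matters for k = 0, when the inner-step count is 0 *)
      exists k : nat,
        [/\ reached T k,
            f (x k 0%N) - fstar <= delta,
            forall j, (j < k)%N -> delta < f (x j 0%N) - fstar,
            k%:Z <= K_SC beta v gap eb
          & (\sum_(j < k) odflt 0%N (T j))%:R
              <= Num.max 0 (inner_bound beta mu G v gap eb)],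
      (fun e : R => (K_SC beta v gap e)%:~R : R) =O_ (0^'+) (fun e : R => e^-1)
    & inner_bound beta mu G v gap =O_ (0^'+) (fun e : R => e^-1)].
Proof.
move=> eb delta gap.
have [/andP[b0 b1] /andP[eb0 _]] := (hbeta, heb).
pose g k := f (x k 0%N) - fstar.
pose Tn k := odflt 0%N (T k).
pose inaccurate k := forall j, (j < k)%N -> delta < g j.
have far k : reached T k -> 2 * eb / (beta * v) < g k -> exists N,
    [/\ T k = Some N.+1,
    N%:R <= 16 / (1 - beta) ^+ 2 * (G ^+ 2 / ((1 - v) * mu ^+ 2) - 1)
  & g k.+1 <= g k - (v^-1 - 1) * eb].
  exact: (far_iteration pb f fstar beta rho S U Jg Js x F T eps1 eps2 G mu v
    hconv hfstar hbeta hrun heps hG0 hG hbundle hmu0 hsharp eb erefl eb0 hv hrho).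
have near k : reached T k -> delta < g k -> g k <= 2 * eb / (beta * v) ->
  exists N, [/\ T k = Some N.+1,
    N.+1%:R <= 16 * G ^+ 2 * eb / (beta * mu ^+ 2 * v * (1 - beta) ^+ 2)
                / ((g k - 2 * eb / beta) / 2) - 15 / (1 - beta) ^+ 2
  & g k.+1 <= (1 - beta / 2) * g k + eb].
  exact: (near_iteration pb f fstar beta rho S U Jg Js x F T eps1 eps2 G mu v
    hconv hfstar hbeta hrun heps hG0 hG hbundle hmu0 hsharp eb erefl eb0 hv hrho).
have finite k : reached T k -> delta < g k -> exists N, T k = Some N.+1.
  move=> hk big; have [h|h] := lerP (g k) (2 * eb / (beta * v)).
    by have [N [TN _ _]] := near k hk big h; exists N.
  by have [N [TN _ _]] := far k hk h; exists N.
have farK K : reached T K -> forall j, (j < K)%N ->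
    2 * eb / (beta * v) < g j -> g j.+1 <= g j - (v^-1 - 1) * eb.
  move=> hK j jK /far; case; first exact: reached_lt (ltnW jK) hK.
  by move=> N [].
have nearK K : reached T K -> inaccurate K -> forall j, (j < K)%N ->
    g j <= 2 * eb / (beta * v) -> g j.+1 <= (1 - beta / 2) * g j + eb.
  move=> hK iK j jK /near; case; [|exact: iK|by move=> N []].
  exact: reached_lt (ltnW jK) hK.
have count K : reached T K -> inaccurate K -> K%:Z <= K_SC beta v gap eb.
  move=> hK iK.
  exact: (outer_count beta v eb g K hbeta hv eb0 iK (farK K hK) (nearK K hK iK)).
have [k [hk ik gk]] : exists k, [/\ reached T k, inaccurate k & g k <= delta].
  apply: contrapT => none.
  (* Both properties advance together: inaccuracy at k is what makes inner loop k terminate, so that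
     iteration k + 1 is reached. *)
  have all k : reached T k /\ inaccurate k.
    elim: k => [|k [hk ik]]; first by split.
    have big : delta < g k.
      by rewrite ltNge; apply/negP => gk; apply: none; exists k.
    have [N TN] := finite k hk big.
    split=> j; rewrite ltnS leq_eqVlt => /orP[/eqP ->|jk] //.
    - by rewrite TN.
    - exact: hk.
    - exact: ik.
  have [h1 h2] := all `|K_SC beta v gap eb|%N.+1.
  have := le_trans (count _ h1 h2) (lez_abs _).
  by rewrite lez_nat ltnn.
split; [exists k; split => // | exact: K_SC_asymptotic | exact: inner_bound_asymptotic].
  exact: count.
apply: (inner_count beta v eb mu G g k hbeta hv eb0 hmu0 hG0 Tn ik
  (farK k hk) (nearK k hk ik)) => [j jk h|j jk h|k0].
- have [N [TN NN _]] := far j (reached_lt _ _ _ (ltnW jk) hk) h.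
  by rewrite /Tn TN /= -natr1 lerD2r.
- have [N [TN NN _]] := near j (reached_lt _ _ _ (ltnW jk) hk) (ik j jk) h.
  by rewrite /Tn TN.
apply: (sharpness_le_lipschitz pb f fstar beta rho S U Jg Js x F T eps1 eps2 G
  mu hfstar hbeta hrun heps hG0 hG hmu0 hsharp eb erefl eb0 0%N) => //.
exact: ik.
Qed.
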